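(* Fix $s,t\in\mathbb{N}$ with $t\ge\max\{s,3\}$. The underlying treewidth of the class of $K_{s,t}$-minor-free graphs equals $s$. Moreover, there is a constant $C_{s,t}$ such that every $K_{s,t}$-minor-free graph $G$ of treewidth $k\ge2$ satisfies $\mathrm{tpw}_s(G)\le C_{s,t}\,k^2\log k$.
   Context: Graphs are finite, simple and undirected; $\mathrm{tw}$ denotes treewidth. For graphs $G,H$, an $H$-partition of $G$ is a partition $(V_x : x\in V(H))$ of $V(G)$ such that for every edge $vw$ of $G$ with $v\in V_x$, $w\in V_y$, either $x=y$ or $xy\in E(H)$; its width is $\max_x|V_x|$. $\mathrm{tpw}_c(G)$ is the minimum width of an $H$-partition of $G$ over all graphs $H$ with $\mathrm{tw}(H)\le c$. The underlying treewidth of a graph class $\mathcal{G}$ is the minimum $c\in\mathbb{N}_0$ for which there is a function $f$ with $\mathrm{tpw}_c(G)\le f(\mathrm{tw}(G))$ for all $G\in\mathcal{G}$ (unbounded if no such $c$ exists). *)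

(* Defs.v *)
From Stdlib Require Import Reals.
From mathcomp Require Import all_boot.
Set Implicit Arguments.
Unset Strict Implicit.
Unset Printing Implicit Defensive.

Record sgraph := SGraph {
  svert :> finType;
  sadj : rel svert;
  sadj_sym : symmetric sadj;
  sadj_irrefl : irreflexive sadj }.

(* S induces a connected subgraph of G (vacuous for S empty). *)
Definition induced_connected (G : sgraph) (S : {set G}) : Prop :=
  forall x y, x \in S -> y \in S ->
    connect [rel u v | [&& sadj u v, u \in S & v \in S]] x y.

Definition nedges (G : sgraph) : nat :=
  #|[set p : G * G | sadj p.1 p.2]| %/ 2.

Definition is_tree (T : sgraph) : Prop :=
  0 < #|T| /\ (forall x y : T, connect (@sadj T) x y) /\ nedges T = #|T| - 1.

Definition tree_decomposition (G T : sgraph) (B : T -> {set G}) : Prop :=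
  [/\ is_tree T,
      (forall v : G, exists x : T, v \in B x),
      (forall v w : G, sadj v w -> exists x : T, (v \in B x) && (w \in B x)) &
      (forall v : G, induced_connected [set x : T | v \in B x])].

Definition tw_le (G : sgraph) (k : nat) : Prop :=
  exists (T : sgraph) (B : T -> {set G}),
    tree_decomposition B /\ forall x : T, #|B x| <= k.+1.

Definition is_tw (G : sgraph) (k : nat) : Prop :=
  tw_le G k /\ forall j, j < k -> ~ tw_le G j.

(* An H-partition of G given by the map sending a vertex to its part index:
   the part V_x is the set of vertices mapped to x. Its width is <= m. *)
Definition H_partition (G H : sgraph) (part : G -> H) : Prop :=
  forall v w : G, sadj v w -> part v = part w \/ sadj (part v) (part w).

Definition partition_width_le (G H : sgraph) (part : G -> H) (m : nat) : Prop :=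
  forall x : H, #|[set v : G | part v == x]| <= m.

Definition tpw_le (c : nat) (G : sgraph) (m : nat) : Prop :=
  exists (H : sgraph) (part : G -> H),
    tw_le H c /\ H_partition part /\ partition_width_le part m.

Definition utw_bounded (P : sgraph -> Prop) (c : nat) : Prop :=
  exists f : nat -> nat, forall G : sgraph, P G ->
    forall k, is_tw G k -> tpw_le c G (f k).

Definition underlying_tw_eq (P : sgraph -> Prop) (c : nat) : Prop :=
  utw_bounded P c /\ forall c', c' < c -> ~ utw_bounded P c'.

Definition minor (H G : sgraph) : Prop :=
  exists phi : H -> {set G},
    [/\ (forall x, phi x != set0),
        (forall x y, x != y -> [disjoint phi x & phi y]),
        (forall x, induced_connected (phi x)) &
        (forall x y, sadj x y -> exists v w, [&& v \in phi x, w \in phi y & sadj v w])].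

Definition kst_adj (s t : nat) : rel ('I_s + 'I_t)%type :=
  fun a b => match a, b with
             | inl _, inr _ | inr _, inl _ => true
             | _, _ => false end.

Arguments kst_adj : clear implicits.


Lemma kst_sym (s t : nat) : symmetric (kst_adj s t).
Proof. by case=> a [] b. Qed.

Lemma kst_irrefl (s t : nat) : irreflexive (kst_adj s t).
Proof. by case. Qed.

Definition K_bip (s t : nat) : sgraph :=
  @SGraph ('I_s + 'I_t)%type (kst_adj s t) (@kst_sym s t) (@kst_irrefl s t).

Definition Kst_minor_free (s t : nat) (G : sgraph) : Prop := ~ minor (K_bip s t) G.

(* Main.v *)
(** Upper bound.  The parts are built one at a time so that every connected set avoiding the
    parts built so far touches at most s of them, pairwise adjacent, in at most 2(k+1) vertices
    each; the parts touched by a component Y become the neighbours of the next part, which is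
    taken inside Y, so that the quotient graph has an elimination ordering of width s.  If Y
    touches s parts, the connected subsets of Y touching all of them have the Erdős–Pósa
    property: either many of them are disjoint, and together with the O(k) vertices of the parts
    seen from Y they form a bipartite graph in which each has s neighbours, dense enough to
    contain a K_{s,t} minor, or they are hit by O(k) bags.  Closing the set of these bags under
    lowest common ancestors makes every remaining component see at most two of them, and the
    union of the bags inside Y is the next part.  Its size is O(k^2), with no logarithm.

    Lower bound.  Starting from a long path, repeatedly take many disjoint copies and add a
    dominant vertex.  After s - 1 steps the graph has treewidth at most s and no K_{s,t} minor,
    but since some copy avoids the part of the dominant vertex, the quotient of any partition of
    bounded width contains a clique on s + 1 vertices. *)

Require Import Defs.
From Stdlib Require Import Reals Lra Classical.
From mathcomp Require Import all_boot zify.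
Set Implicit Arguments.
Unset Strict Implicit.
Unset Printing Implicit Defensive.

(** * Connected vertex sets and contact between them *)

Section Connectivity.
Variable G : sgraph.
Implicit Types (S X Y Z : {set G}) (u v x y : G).

Definition inrel S : rel G := [rel u v | [&& sadj u v, u \in S & v \in S]].

Lemma inrelE S u v : inrel S u v = [&& sadj u v, u \in S & v \in S].
Proof. by []. Qed.

Definition conn S := [forall x in S, forall y in S, connect (inrel S) x y].

Lemma connP S : reflect (induced_connected S) (conn S).
Proof.
apply: (iffP forall_inP) => h.
  by move=> x y xS yS; move/forall_inP: (h x xS); apply.
by move=> x xS; apply/forall_inP => y yS; apply: h.
Qed.

Definition touch X Y := [exists x in X, exists y in Y, sadj x y].

Lemma touchP X Y :
  reflect (exists x y, [/\ x \in X, y \in Y & sadj x y]) (touch X Y).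
Proof.
apply: (iffP exists_inP) => [[x xX /exists_inP[y yY xy]]|[x [y [xX yY xy]]]].
  by exists x, y.
by exists x => //; apply/exists_inP; exists y.
Qed.

Lemma touchC X Y : touch X Y = touch Y X.
Proof.
by apply/touchP/touchP => -[x [y [xX yY xy]]]; exists y, x; rewrite sadj_sym.
Qed.

Lemma touchSS X X' Y Y' : X \subset X' -> Y \subset Y' -> touch X Y -> touch X' Y'.
Proof.
move=> /subsetP sX /subsetP sY /touchP[x [y [/sX xX /sY yY xy]]].
by apply/touchP; exists x, y.
Qed.

Lemma inrel_sym S : symmetric (inrel S).
Proof. by move=> x y; rewrite !inrelE (sadj_sym x y) [(x \in S) && _]andbC. Qed.

Lemma connect_inrel_sym S : connect_sym (inrel S).
Proof. exact: sym_connect_sym (inrel_sym S). Qed.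

Lemma connect_inrelS X Y x y : X \subset Y -> connect (inrel X) x y -> connect (inrel Y) x y.
Proof.
move=> /subsetP sXY; apply: connect_sub => {x y} u v /and3P[uv uX vX].
by apply: connect1; rewrite inrelE uv !sXY.
Qed.

(** Propagation along the edges inside [S]; it stands in for inductions along paths. *)
Lemma conn_ind S (A : {pred G}) x :
  conn S -> x \in S -> x \in A ->
  (forall u v, u \in S -> v \in S -> sadj u v -> u \in A -> v \in A) ->
  {subset S <= A}.
Proof.
move=> /connP cS xS xA hA y yS; have /connectP[p pp ->] := cS x y xS yS.
elim: p x {xS} xA pp => //= z p IH x xA /andP[/and3P[xz xS zS]].
exact: IH (hA _ _ xS zS xz xA).
Qed.

Lemma conn_hub S x : (forall y, y \in S -> connect (inrel S) x y) -> conn S.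
Proof.
move=> h; apply/connP => y z yS zS; apply: connect_trans (h z zS).
by rewrite connect_inrel_sym h.
Qed.

Lemma conn1 x : conn [set x].
Proof. by apply: (@conn_hub _ x) => y /set1P ->. Qed.

Lemma conn0 : conn set0.
Proof. by apply/connP => x y; rewrite inE. Qed.

Lemma connU_meet X Y x : conn X -> conn Y -> x \in X -> x \in Y -> conn (X :|: Y).
Proof.
move=> /connP cX /connP cY xX xY; apply: (@conn_hub _ x) => y /setUP[yX|yY].
  by apply: connect_inrelS (cX x y xX yX); rewrite subsetUl.
by apply: connect_inrelS (cY x y xY yY); rewrite subsetUr.
Qed.

Lemma connU X Y : conn X -> conn Y -> touch X Y -> conn (X :|: Y).
Proof.
move=> cX cY /touchP[x [y [xX yY xy]]].
(* The edge is itself a connected set meeting both [X] and [Y], which reduces the claim to unions of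
   sets sharing a vertex. *)
have cxy : conn [set x; y].
  apply: (@conn_hub _ x) => z /set2P[]-> //.
  by apply: connect1; rewrite inrelE xy !inE !eqxx orbT.
have -> : X :|: Y = (X :|: [set x; y]) :|: Y.
  apply/setP => z; rewrite !inE.
  by case: eqP => [->|_]; case: eqP => [->|_]; rewrite ?xX ?yY ?orbT ?orbF.
apply: (@connU_meet _ _ y) => //; last by rewrite !inE eqxx !orbT.
by apply: (@connU_meet _ _ x) => //; rewrite !inE eqxx.
Qed.

Lemma conn_meetU X Y : conn X -> conn Y -> ~~ [disjoint X & Y] -> conn (X :|: Y).
Proof.
move=> cX cY /pred0Pn[x /andP[xX xY]]; exact: (connU_meet cX cY xX xY).
Qed.

End Connectivity.

(** * Counting tools *)

Lemma double_counting (I J : finType) (A : {set I}) (B : {set J}) (N : J -> {set I}) :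
  (forall b, b \in B -> N b \subset A) ->
  \sum_(b in B) #|N b| = \sum_(a in A) #|[set b in B | a \in N b]|.
Proof.
move=> sN; transitivity (\sum_(b in B) \sum_(a in A | a \in N b) 1).
  apply: eq_bigr => b bB; rewrite -sum1_card; apply: eq_bigl => a.
  by rewrite andb_idl // => /(subsetP (sN b bB)).
rewrite (exchange_big_dep (mem A)) /=; last by move=> b a _ /andP[].
apply: eq_bigr => a aA; rewrite -sum1_card; apply: eq_bigl => b.
by rewrite inE aA.
Qed.

Lemma exists_subset_card (I : finType) (A : {set I}) n :
  n <= #|A| -> exists2 B : {set I}, B \subset A & #|B| = n.
Proof.
move=> nA; exists [set:: take n (enum A)].
  by apply/subsetP => x; rewrite inE => /mem_take; rewrite mem_enum.
rewrite cardsE; have /card_uniqP -> : uniq (take n (enum A)) by rewrite take_uniq ?enum_uniq.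
by rewrite size_takel // -cardE.
Qed.

Lemma disjointUl (I : finType) (A B C : {set I}) :
  [disjoint A :|: B & C] = [disjoint A & C] && [disjoint B & C].
Proof. by rewrite -!setI_eq0 setIUl setU_eq0. Qed.

(** * Complete bipartite minors in dense bipartite families of branch sets *)

Section BranchSets.
Variable G : sgraph.
Implicit Types (A B U V : {set {set G}}) (X Y Z a b : {set G}).

(** A minor model is an unindexed family of vertex sets, so numbers of branch sets are cardinalities
    and submodels are subsets. *)
Definition branch_sets U := [&& trivIset U, set0 \notin U & [forall X in U, conn X]].

Lemma branch_setsP U :
  reflect [/\ {in U &, forall X Y, X != Y -> [disjoint X & Y]},
              {in U, forall X, X != set0} & {in U, forall X, conn X}]
          (branch_sets U).
Proof.
apply: (iffP and3P) => -[h1 h2 h3]; split; [exact/trivIsetP| | |exact/trivIsetP| |].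
- by move=> X XU; apply: contraNneq h2 => <-.
- exact/forall_inP.
- by apply/negP => /h2; rewrite eqxx.
- exact/forall_inP.
Qed.

Lemma branch_setsS U V : U \subset V -> branch_sets V -> branch_sets U.
Proof.
move=> /subsetP UV /branch_setsP[h1 h2 h3]; apply/branch_setsP; split.
- by move=> X Y /UV XV /UV YV; apply: h1.
- by move=> X /UV; apply: h2.
- by move=> X /UV; apply: h3.
Qed.

(** An auxiliary bipartite graph with sides [A] and [B]: [N b] selects exactly [s] of the members of
    [A] that [b] touches, possibly among more. *)
Definition adapted s A B (N : {set G} -> {set {set G}}) :=
  forall b, b \in B -> [/\ N b \subset A, #|N b| = s & {in N b, forall a, touch a b}].

Definition codegree_set B (N : {set G} -> {set {set G}}) a a' :=
  [set b in B | (a \in N b) && (a' \in N b)].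

(** Take a common neighbour [c], replace [a] and [a'] by the connected union of [a], [c] and [a'],
    and drop from [B] all common neighbours of [a] and [a']. Each survivor had at most one of the
    two in its selection, so it keeps [s] distinct neighbours. *)
Lemma contract_step s t A B N a a' :
  branch_sets (A :|: B) -> [disjoint A & B] -> adapted s A B N ->
  a \in A -> a' \in A -> a != a' ->
  0 < #|codegree_set B N a a'| <= t ->
  exists A1 B1 N1, [/\ branch_sets (A1 :|: B1), [disjoint A1 & B1], adapted s A1 B1 N1 &
    [/\ #|A1| < #|A|, #|B| <= #|B1| + t, B1 \subset B & cover (A1 :|: B1) \subset cover (A :|: B)]].
Proof.
move=> bAB dAB aN aA a'A aa' /andP[/card_gt0P[c]].
rewrite inE => /and3P[cB aNc a'Nc] cod.
have [/branch_setsP[h1 h2 h3]] := bAB; have [sNc _ tNc] := aN c cB.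
have nAB z : z \in A -> z \in B -> False.
  by move=> zA zB; move/pred0P/(_ z): dAB; rewrite /= zA zB.
have inU z : z \in A -> z \in A :|: B by rewrite inE => ->.
have inV z : z \in B -> z \in A :|: B by rewrite inE orbC => ->.
pose n := a :|: c :|: a'; pose D := codegree_set B N a a'.
pose m Z := if (Z == a) || (Z == a') then n else Z.
have an : a \subset n by rewrite /n -setUA subsetUl.
have a0 : a != set0 by apply/h2/inU.
have dn Z : Z \in A :|: B -> Z != a -> Z != a' -> Z != c -> [disjoint n & Z].
  move=> ZU Za Za' Zc; rewrite /n !disjointUl -andbA; apply/and3P; split; apply: h1; rewrite 1?eq_sym //; auto.
have nU Z : Z \in A :|: B -> Z = n -> Z = a.
  move=> ZU Zn; apply/eqP; apply: contraNT a0 => /h1 h.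
  have := h ZU (inU _ aA); rewrite Zn => /(disjointWl an).
  by rewrite -setI_eq0 setIid.
exists (n |: (A :\ a :\ a')), (B :\: D), (fun X => m @: N X); split.
- apply/branch_setsP.
  have cn : conn n.
    have cac : conn (a :|: c) by apply: connU; [auto | auto | exact: tNc].
    apply: connU; [exact: cac | by auto | rewrite touchC].
    by apply: touchSS (tNc _ a'Nc); rewrite // subsetUr.
  have hU Z : Z \in (n |: (A :\ a :\ a')) :|: (B :\: D) ->
     Z = n \/ [/\ Z \in A :|: B, Z != a, Z != a' & Z != c].
    rewrite !inE => /orP[/orP[/eqP|/and3P[za' za zA]]|/andP[zD zB]]; [by left|right|right].
      by split=> //; [rewrite zA|apply/eqP => zc; apply: (nAB c); rewrite // -zc].
    split; rewrite ?zB ?orbT //; apply/eqP => E.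
    + by apply: (nAB Z) => //; rewrite E.
    + by apply: (nAB Z) => //; rewrite E.
    + by move: zD; rewrite E cB aNc a'Nc.
  split=> [X Y /hU[->|[XU Xa Xa' Xc]] /hU[->|[YU Ya Ya' Yc]] XY|X /hU[->|[XU _ _ _]]|X /hU[->|[XU _ _ _]]]; auto.
  + by rewrite eqxx in XY.
  + by rewrite disjoint_sym dn.
  + by apply: contraNneq a0 => n0; rewrite -subset0 -n0.
- apply/pred0P => Z /=; apply/negP => /andP[+ /setDP[ZB _]].
  rewrite !inE => /orP[/eqP Zn|/and3P[_ _ ZA]]; last exact: (nAB Z).
  by apply: (nAB Z) => //; rewrite (nU Z) // inV.
- move=> b /setDP[bB bD]; have [sNb cNb tNb] := aN b bB.
  split.
  + apply/subsetP => z /imsetP[Z ZN ->]; rewrite /m; case: ifP => [_|/norP[Za Za']].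
      by rewrite setU11.
    by rewrite !inE Za Za' (subsetP sNb _ ZN) orbT.
  + rewrite card_in_imset // => Z Z' ZN Z'N; rewrite /m.
    have ZU := inU _ (subsetP sNb _ ZN); have Z'U := inU _ (subsetP sNb _ Z'N).
    have na : ~ (a \in N b /\ a' \in N b) by case=> u v; move: bD; rewrite inE bB u v.
    case: ifP => [|/norP[Za Za']]; case: ifP => [|/norP[Za2 Za2']] //.
    * move=> /orP[]/eqP E /orP[]/eqP E'; subst => // _; case: na; by [].
    * by move=> _ E; move: Za2; rewrite (nU Z') ?eqxx.
    * by move=> _ E; move: Za; rewrite (nU Z) ?eqxx.
  + move=> z /imsetP[Z ZN ->]; rewrite /m; case: ifP => [Zaa|_]; last exact: tNb.
    apply: touchSS (tNb _ ZN) => //.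
    by case/orP: Zaa => /eqP->; rewrite // /n subsetUr.
- split.
  + have := cardsD1 a A; have := cardsD1 a' (A :\ a); have := cardsU1 n (A :\ a :\ a').
    have -> : a' \in A :\ a by rewrite !inE eq_sym aa'.
    by rewrite aA; case: (_ \notin _); rewrite /= ?add1n ?add0n => -> -> ->; rewrite ?ltnS ?leqnSn.
  + have := cardsID D B; have -> : B :&: D = D by apply/setIidPr/subsetP => z; rewrite inE => /andP[].
    by rewrite -/D in cod; lia.
  + exact: subsetDl.
  + apply/subsetP => x /bigcupP[Z]; rewrite !inE => h xZ.
    have sub W : W \in A :|: B -> x \in W -> x \in cover (A :|: B) by move=> WU xW; apply/bigcupP; exists W.
    case/orP: h => [/orP[/eqP Zn|/and3P[_ _ ZA]]|/andP[_ ZB]].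
    * by move: xZ; rewrite Zn !inE => /orP[/orP[]|]; apply: sub; auto.
    * by apply: sub xZ; auto.
    * by apply: sub xZ; auto.
Qed.

(* Contract a, b, a' whenever a, a' have few common neighbours; when no such pair is left,
   the link of a vertex a of large degree is dense enough for the induction on s.
   The t-side of the minor always consists of members of B. *)
Lemma dense_bipartite_minor s t A B N :
  0 < t -> branch_sets (A :|: B) -> [disjoint A & B] -> adapted s A B N ->
  s`! * t * #|A|.+1 <= #|B| ->
  exists XX YY : {set {set G}},
    [/\ #|XX| = s, #|YY| = t, YY \subset B &
    [/\ branch_sets (XX :|: YY), [disjoint XX & YY], cover XX \subset cover (A :|: B) &
     forall X Y, X \in XX -> Y \in YY -> touch X Y]].
Proof.
move=> t0; elim: s A B N => [|s IHs] A B N.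
  move=> bAB dAB _; rewrite mul1n => le.
  have [|YY sY cY] := @exists_subset_card _ B t; first by lia.
  exists set0, YY; split; rewrite ?cards0 //; split.
  - by apply: branch_setsS bAB; rewrite set0U subsetU ?sY ?orbT.
  - by rewrite -setI_eq0 set0I.
  - by rewrite /cover big_set0 sub0set.
  - by move=> X Y; rewrite inE.
have [n] := ubnP #|A|; elim: n A B N => // n IHn A B N ltn bAB dAB aN le.
(* The size hypothesis reads [f * #|A|.+1 <= #|B|]. A contraction costs at least one member of [A]
   and at most [f] members of [B], so it preserves this inequality. *)
pose f := (s.+1)`! * t; have f0 : 0 < f by rewrite muln_gt0 fact_gt0.
case: (boolP [exists a in A, exists a' in A, (a != a') && (0 < #|codegree_set B N a a'| <= f)]).
  move=> /exists_inP[a aA /exists_inP[a' a'A /andP[aa' cod]]].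
  have [A1 [B1 [N1 [b1 d1 n1 [lA lB sB sC]]]]] := contract_step bAB dAB aN aA a'A aa' cod.
  have [||XX [YY [h1 h2 h3 [h4 h5 h6 h7]]]] := IHn _ _ _ _ b1 d1 n1; first by lia.
    by rewrite -/f in le *; nia.
  exists XX, YY; split => //; first exact: subset_trans sB.
  by split => //; apply: subset_trans sC.
move=> /exists_inPn nocod.
have cod a a' : a \in A -> a' \in A -> a != a' -> 0 < #|codegree_set B N a a'| -> f < #|codegree_set B N a a'|.
  move=> aA a'A aa' p; move/exists_inPn/(_ a' a'A): (nocod a aA).
  by rewrite aa' p /= -ltnNge.
have sN b : b \in B -> N b \subset A by case/aN.
(* By averaging: the members of [B] have [s.+1] selected neighbours each, which makes more than
   [f * #|A|] incidences. *)
have [a aA dega] : exists2 a, a \in A & f <= #|[set b in B | a \in N b]|.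
  apply/exists_inP; apply: contraT => /exists_inPn h.
  have := double_counting sN.
  rewrite (eq_bigr (fun _ => s.+1)); last by move=> b /aN[].
  rewrite sum_nat_const => E.
  have : \sum_(a in A) #|[set b in B | a \in N b]| <= \sum_(a in A) f.
    by apply: leq_sum => a /h; rewrite -ltnNge => /ltnW.
  rewrite -E sum_nat_const; move: le; rewrite -/f; move: #|A| #|B| f0 => nA nB; clear; nia.
(* The link of [a]: its neighbours in [B], and the members of [A] sharing one of them. Each of the
   latter shares more than [f], since no contraction is possible. *)
pose Ba := [set b in B | a \in N b].
pose Aa := [set a' in A | (a' != a) && (0 < #|codegree_set B N a a'|)].
have sA : Aa \subset A by apply/subsetP => z; rewrite inE => /andP[].
have sB : Ba \subset B by apply/subsetP => z; rewrite inE => /andP[].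
have sAB : Aa :|: Ba \subset A :|: B by apply: setUSS.
have aN1 : adapted s Aa Ba (fun b => N b :\ a).
  move=> b; rewrite inE => /andP[bB ab]; have [sNb cNb tNb] := aN b bB; split.
  - apply/subsetP => z; rewrite !inE => /andP[za zN]; rewrite za (subsetP sNb _ zN) /=.
    by apply/card_gt0P; exists b; rewrite inE bB ab.
  - by have := cardsD1 a (N b); rewrite ab cNb add1n => -[<-].
  - by move=> z /setD1P[_]; apply: tNb.
have cnt : s * #|Ba| >= #|Aa| * f.
  have := @double_counting _ _ Aa Ba (fun b => N b :\ a) (fun b h => let: And3 h1 _ _ := aN1 b h in h1).
  rewrite (eq_bigr (fun _ => s)); last by move=> b /aN1[].
  rewrite sum_nat_const mulnC => ->; rewrite -sum_nat_const.
  apply: leq_sum => a'; rewrite inE => /and3P[a'A a'a h].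
  rewrite eq_sym in a'a; apply: leq_trans (ltnW (cod _ _ aA a'A a'a h)) _.
  apply/subset_leq_card/subsetP => b; rewrite !inE => /and3P[-> -> ->].
  by rewrite eq_sym a'a.
have [||||XX [YY [h1 h2 h3 [h4 h5 h6 h7]]]] := IHs Aa Ba (fun b => N b :\ a) => //.
- exact: branch_setsS bAB.
- by apply: disjointW dAB.
(* After multiplication by [s.+1], this is the sum of [f * #|Aa| <= s * #|Ba|] and [f <= #|Ba|]. *)
- rewrite -(@leq_pmul2l s.+1) //.
  have -> : s.+1 * (s`! * t * #|Aa|.+1) = f * #|Aa|.+1 by rewrite /f factS !mulnA.
  move: cnt dega; rewrite -/Ba; move: #|Aa| #|Ba| => nA nB; clear; nia.
have [/branch_setsP[q1 q2 q3]] := bAB.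
have [/branch_setsP[p1 p2 p3]] := h4.
(* The model found in the link uses only vertices covered by [Aa] and [Ba], so it avoids [a]; and
   [a] touches all of [YY], which lies in [Ba]. Hence [a] can join the side [XX]. *)
have dis Z : Z \in XX -> [disjoint a & Z].
  move=> ZX; have /subset_trans/(_ h6) sZ : Z \subset cover XX by apply: bigcup_sup.
  apply: disjointWr sZ _; rewrite /cover; apply: bigcup_disjoint => W WU.
  apply: q1; first by rewrite inE aA.
    exact: (subsetP sAB).
  move: WU; rewrite !inE => /orP[/and3P[_ wa _]|/andP[WB _]]; first by rewrite eq_sym.
  by apply: contraTneq dAB => aW; apply/pred0Pn; exists a; rewrite /= aA aW.
have a0 : a != set0 by apply: q2; rewrite inE aA.
have aX : a \notin XX.
  by apply/negP => /dis; rewrite -setI_eq0 setIid (negPf a0).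
have YB : YY \subset B by apply: subset_trans sB.
have ca : conn a by apply: q3; rewrite inE aA.
exists (a |: XX), YY; split; rewrite ?cardsU1 ?aX ?h1 //; split => //.
- have aY Y : Y \in YY -> a != Y.
    by move=> /(subsetP YB) YB'; apply: contraTneq dAB => aW; apply/pred0Pn; exists a; rewrite /= aA aW.
  have daY Y : Y \in YY -> [disjoint a & Y].
    by move=> YY'; apply: q1; rewrite ?inE ?aA ?(subsetP YB _ YY') ?orbT ?aY.
  have key Z : Z \in a |: XX :|: YY -> Z = a \/ Z \in XX :|: YY /\ [disjoint a & Z].
    rewrite -setUA => /setU1P[]; [by left|right]; split => //.
    by case/setUP: b; auto.
  apply/branch_setsP; split.
  + move=> X Y /key[->|[XU dX]] /key[->|[YU dY]] XY //; auto.
      by rewrite eqxx in XY.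
    by rewrite disjoint_sym.
  + by move=> X /key[->|[]]; auto.
  + by move=> X /key[->|[]]; auto.
- rewrite disjointUl h5 andbT disjoints1; apply/negP => /(subsetP YB) aB.
  by case/pred0Pn: dAB; exists a; rewrite /= aA.
- rewrite /cover bigcup_setU big_set1 subUset; apply/andP; split.
    by apply: bigcup_sup; rewrite inE aA.
  apply: subset_trans h6 _; apply/bigcupsP => Z ZU; apply: bigcup_sup; exact: (subsetP sAB).
- move=> X Y /setU1P[->|XX'] YY'; last exact: h7.
  move: (subsetP h3 _ YY'); rewrite inE => /andP[YB' aNY].
  by have [_ _] := aN _ YB'; apply.
Qed.

End BranchSets.

(** * Rooted trees: parents, depths and subtrees *)

Definition rooted (T : sgraph) (p : T -> T) (dep : T -> nat) :=
  (forall x, p x = x \/ dep (p x) < dep x) /\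
  (forall x y, sadj x y -> (y = p x /\ dep y < dep x) \/ (x = p y /\ dep x < dep y)).

Section DistanceFromRoot.
Variables (T : sgraph) (r : T).
Hypothesis Tconn : forall x y : T, connect (@sadj T) x y.

(** The ball of radius [n] around [r], not the sphere. *)
Definition layer n := iter n (fun S : {set T} => [set y | (y \in S) || [exists x in S, sadj x y]]) [set r].

Lemma layer_cover x : exists n, x \in layer n.
Proof.
have /connectP[q] := Tconn r x.
have : r \in layer 0 by rewrite inE.
move: {1 2 3}r 0 => z n; elim: q z n => [|w q IH] z n zn /=; first by move=> _ ->; exists n.
move=> /andP[zw]; apply: (IH _ n.+1).
by rewrite /= inE; apply/orP; right; apply/exists_inP; exists z.
Qed.

Definition dist x := ex_minn (layer_cover x).

Lemma dist_pred x : x != r -> exists2 z, sadj z x & dist z < dist x.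
Proof.
rewrite {2}/dist; case: ex_minnP => [[|n] xn mn] xr; first by rewrite inE (negPf xr) in xn.
move: xn; rewrite /= inE => /orP[/mn|/exists_inP[z zn zx]]; first by rewrite ltnn.
by exists z => //; rewrite /dist; case: ex_minnP => k _ /(_ _ zn).
Qed.

End DistanceFromRoot.

(** Every vertex [z] other than [r] is joined to some [p z] nearer to [r]. These are [#|T| - 1]
    edges, so the edge count of a tree leaves no other edge. The root is a fixed point of [p]. *)
Lemma tree_rooted (T : sgraph) : is_tree T -> exists (p : T -> T) dep, rooted p dep.
Proof.
move=> [/card_gt0P[r _] [Tconn ne]].
pose d := @dist _ r Tconn.
pose p x := odflt x [pick z | sadj z x && (d z < d x)].
have px x : x != r -> sadj (p x) x /\ d (p x) < d x.
  move=> /(dist_pred Tconn)[z zx dz]; rewrite /p; case: pickP => [w /andP[]//|/(_ z)].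
  by rewrite zx dz.
exists p, d; split.
  by move=> x; rewrite /p; case: pickP => [w /andP[_]|_]; [right|left].
move=> x y xy; pose f z : T * T := (z, p z); pose g z : T * T := (p z, z).
pose E := [set q : T * T | sadj q.1 q.2].
pose U := (f @: [set~ r]) :|: (g @: [set~ r]).
have cU : #|U| = (#|T| - 1).*2.
  have dis : [disjoint f @: [set~ r] & g @: [set~ r]].
    apply/pred0P => q /=; apply/negP => /andP[/imsetP[a ar ->] /imsetP[b br [ab ba]]].
    move: ar br; rewrite !inE => /px[_ +] /px[_].
    by rewrite -ab ba; move: (d _) (d _) => m n; lia.
  have := cardsUI (f @: [set~ r]) (g @: [set~ r]).
  rewrite (disjoint_setI0 dis) cards0 addn0 -/U => ->.
  rewrite !card_imset => [|a b []//|a b []//].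
  by rewrite cardsC1 addnn subn1.
have UE : U \subset E.
  apply/subsetP => q /setUP[] /imsetP[a]; rewrite !inE => /px[ap _] -> //.
  by rewrite sadj_sym.
(* A further edge would contribute both orientations, hence one full edge after the halving in
   [nedges]. *)
have EU : (x, y) \in U.
  apply: contraTT isT => nU.
  have nU' : (y, x) \notin U.
    apply: contra nU => /setUP[] /imsetP[a ar [-> ->]]; apply/setUP; [right|left]; apply/imsetP; by exists a.
  have sE : (x, y) |: ((y, x) |: U) \subset E.
    by apply/subsetP => q /setU1P[->|/setU1P[->|/(subsetP UE)//]]; rewrite inE //= sadj_sym.
  have := subset_leq_card sE.
  have nU2 : (x, y) \notin (y, x) |: U.
    apply/negP => /setU1P[[e _]|]; last exact/negP.
    by move: xy; rewrite e sadj_irrefl.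
  rewrite !cardsU1 nU' nU2 cU /=.
  by move: ne; rewrite /nedges -/E; move: #|E| #|T| => m n; clear; lia.
by case/setUP: EU => /imsetP[a]; rewrite !inE => /px[_ da] [-> ->]; [left|right].
Qed.

Section Rooted.
Variables (T : sgraph) (p : T -> T) (dep : T -> nat).
Hypothesis rT : rooted p dep.
Implicit Types (Z : {set T}) (x y z : T).

Definition desc x := [set y | fconnect p y x].

Lemma desc_refl x : x \in desc x.
Proof. by rewrite inE. Qed.

Lemma desc_trans x y z : x \in desc y -> y \in desc z -> x \in desc z.
Proof. by rewrite !inE; apply: connect_trans. Qed.

Lemma desc_parent x : x \in desc (p x).
Proof. by rewrite inE; apply: fconnect1. Qed.

Lemma desc_step x y : y \in desc x -> y != x -> p y \in desc x.
Proof.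
rewrite !inE => /iter_findex; case: findex => [/= ->|n]; first by rewrite eqxx.
by rewrite iterSr => <- _; apply: fconnect_iter.
Qed.

Lemma desc_dep x y : y \in desc x -> y = x \/ dep x < dep y.
Proof.
rewrite inE => /iter_findex <-; move: (findex _ _ _) => n; elim: n => [|n [IH|IH]] /=; first by left.
  by rewrite -IH; case: (rT.1 y) => [->|]; [left|right].
right; case: (rT.1 (iter n p y)) => [->//|h]; exact: ltn_trans h IH.
Qed.

(** Both [x] and [y] lie on the orbit of [z] under [p], and the one reached later is an iterate of
    the other. *)
Lemma desc_laminar x y z : z \in desc x -> z \in desc y -> x \in desc y \/ y \in desc x.
Proof.
rewrite !inE => /iter_findex; move: (findex _ _ _) => m mx /iter_findex; move: (findex _ _ _) => n ny.
by case: (leqP m n) => mn; [left; rewrite -ny -mx|right; rewrite -ny -mx];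
  [rewrite -(subnK mn)|rewrite -(subnK (ltnW mn))]; rewrite iterD fconnect_iter.
Qed.

(** An edge leaving the subtree of [x] can only join [x] to its parent. *)
Lemma conn_sub_desc Z x z : conn Z -> z \in Z -> z \in desc x -> x \notin Z -> Z \subset desc x.
Proof.
move=> cZ zZ zx xZ; apply/subsetP; apply: conn_ind cZ zZ zx _ => u v uZ vZ uv ux.
have [[-> _]|[e _]] := rT.2 _ _ uv; last by apply: desc_trans ux; rewrite e desc_parent.
by apply: desc_step ux _; apply: contraNneq xZ => <-.
Qed.

(** Take the vertex of least depth: an edge leaving its subtree would lead to its parent, which is
    less deep. *)
Lemma conn_top Z : conn Z -> Z != set0 -> exists2 x, x \in Z & Z \subset desc x.
Proof.
move=> cZ /set0Pn[x0 x0Z]; have [x xZ mx] := arg_minnP dep x0Z.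
exists x => //; apply/subsetP; apply: (conn_ind cZ xZ (desc_refl x)) => u v uZ vZ uv ux.
have [[e dv]|[e _]] := rT.2 _ _ uv; last by apply: desc_trans ux; rewrite e desc_parent.
rewrite e; apply: desc_step ux _; apply/eqP => ux.
by move: (mx _ vZ) dv; rewrite ux leqNgt => /negPf ->.
Qed.

(* The subtrees meeting Z but avoiding its top lie strictly below it. *)
Lemma conn_meet_top Z Z' x x' z : conn Z' -> Z \subset desc x -> x' \in Z' ->
  dep x' <= dep x -> z \in Z -> z \in Z' -> x \in Z'.
Proof.
move=> cZ' sZ x'Z' le zZ zZ'; apply: contraT => xZ'.
have /subsetP/(_ _ x'Z')/desc_dep := conn_sub_desc cZ' zZ' (subsetP sZ _ zZ) xZ'.
by case=> [e|]; [rewrite -e x'Z' in xZ'|rewrite ltnNge le].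
Qed.

End Rooted.

(** * Closure under lowest common ancestors *)

Section Closure.
Variables (T : sgraph) (p : T -> T) (dep : T -> nat).
Hypothesis rT : rooted p dep.
Implicit Types (S Z : {set T}) (x y z b : T).
Let D := desc p.

(** Here the exit from the subtree is blocked at the parent of [x] rather than at [x]; a root has no
    exit. *)
Lemma conn_sub_desc_parent Z x z : conn Z -> z \in Z -> z \in D x ->
  p x \notin Z \/ p x = x -> Z \subset D x.
Proof.
move=> cZ zZ zx xZ; apply/subsetP; apply: (conn_ind cZ zZ zx) => u v uZ vZ uv ux.
have [[e _]|[e _]] := rT.2 _ _ uv; last by apply: desc_trans ux; rewrite e desc_parent.
have [eu|nu] := eqVneq u x; last by rewrite e; apply: desc_step ux nu.
case: xZ => [|xx]; first by rewrite -eu -e vZ.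
by rewrite e eu xx desc_refl.
Qed.

Lemma desc_anti x y : x \in D y -> y \in D x -> x = y.
Proof.
move=> /(desc_dep rT)[//|xy] /(desc_dep rT)[//|]; by rewrite ltnNge (ltnW xy).
Qed.

(** Stated without a meet operation: if [y] is the lowest common ancestor of two members of [S], the
    top [b] of [S :&: D y] must be [y] itself. *)
Definition lca_closed S := forall y a, a \in S -> a \in D y ->
  exists b, [/\ b \in S, b \in D y & S :&: D y \subset D b].

(** Adding [s] to a closed set [S1] requires at most one further node, the deepest ancestor [m] of
    [s] with a member of [S1] below it; hence the factor 2. *)
Lemma lca_closure S : exists S', [/\ S \subset S', #|S'| <= 2 * #|S| & lca_closed S'].
Proof.
have [n] := ubnP #|S|; elim: n S => // n IH S ltn.
have [->|[s sS]] := set_0Vmem S.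
  by exists set0; split; rewrite ?cards0 // => y a; rewrite inE.
have [|S1 [sub card cl]] := IH (S :\ s); first by move: ltn; rewrite (cardsD1 s S) sS.
have cS : #|S| = #|S :\ s|.+1 by rewrite (cardsD1 s S) sS.
have sub' S2 : S1 \subset S2 -> s \in S2 -> S \subset S2.
  move=> /subsetP sS2 s2; apply/subsetP => x xS; have [->//|xs] := eqVneq x s.
  by apply/sS2/(subsetP sub); rewrite !inE xs.
pose A := [set m | (s \in D m) && [exists a in S1, a \in D m]].
have inA y a : s \in D y -> a \in S1 -> a \in D y -> y \in A.
  by move=> sy aS ay; rewrite inE sy /=; apply/exists_inP; exists a.
have [A0|[m0 m0A]] := set_0Vmem A.
  exists (s |: S1); split; first by apply: sub'; rewrite ?subsetUr ?setU11.
    by rewrite cardsU1 cS mulnS; move: card; case: (_ \notin _); move: #|S1| #|_ :\ _| => a b; clear; lia.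
  have noA y a : s \in D y -> a \in S1 -> a \in D y -> False.
    by move=> h1 h2 h3; move: (inA _ _ h1 h2 h3); rewrite A0 inE.
  move=> y a; have [sy _ _|sy] := boolP (s \in D y).
    exists s; split; rewrite ?setU11 //; apply/subsetP => c /setIP[/setU1P[->|cS1] cy].
      exact: desc_refl.
    by case: (noA y c).
  move=> /setU1P[->|aS] ay; first by rewrite ay in sy.
  have [b [bS by' sb]] := cl y a aS ay; exists b; split; rewrite // ?inE ?bS ?orbT //.
  apply/subsetP => c /setIP[/setU1P[->|cS1] cy]; first by rewrite cy in sy.
  by apply: (subsetP sb); rewrite inE cS1.
have [m mA mm] := arg_maxnP dep m0A.
have : m \in A by [].
rewrite inE => /andP[sm /exists_inP[a0 a0S a0m]].
exists (s |: (m |: S1)); split; first by apply: sub'; rewrite ?setU11 // setUA subsetUr.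
  rewrite !cardsU1 cS mulnS; move: card; move: #|S1| #|_ :\ _| => a b.
  by case: (_ \notin _); case: (_ \notin _); clear; lia.
have low y a : s \in D y -> a \in S1 -> a \in D y -> m \in D y.
  move=> sy aS ay; have yA := inA _ _ sy aS ay.
  have [//|/(desc_dep rT)[->|]] := desc_laminar sm sy; first exact: desc_refl.
  by move: (mm _ yA); rewrite /= leqNgt => /negPf ->.
move=> y a aS ay; have [sy|sy] := boolP (s \in D y); last first.
  have my : m \notin D y by apply: contra sy; apply: desc_trans.
  have {}aS : a \in S1 by case/setU1P: aS ay sy => [->->//|/setU1P[->|//]]; rewrite (negPf my).
  have [b [bS by' sb]] := cl y a aS ay; exists b; split; rewrite // ?inE ?bS ?orbT //.
  apply/subsetP => c /setIP[/setU1P[->|/setU1P[->|cS1]] cy]; first by rewrite cy in sy.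
    by rewrite cy in my.
  by apply: (subsetP sb); rewrite inE cS1.
have [|my] := boolP (m \in D y); last first.
  exists s; split; rewrite ?setU11 //.
  apply/subsetP => c /setIP[/setU1P[->|/setU1P[->|cS1]] cy]; first exact: desc_refl.
    by rewrite cy in my.
  by rewrite (low y c) in my.
move=> my; have a0y : a0 \in D y by apply: desc_trans my.
have [b [bS by' sb]] := cl y a0 a0S a0y.
have a0b : a0 \in D b by apply: (subsetP sb); rewrite inE a0S.
have [bm|mb] := desc_laminar a0b a0m.
  exists m; split; rewrite // ?inE ?eqxx ?orbT //.
  apply/subsetP => c /setIP[/setU1P[->|/setU1P[->|cS1]] cy]; rewrite ?desc_refl //.
  by apply: desc_trans bm; apply: (subsetP sb); rewrite inE cS1.
exists b; split; rewrite // ?inE ?bS ?orbT //.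
apply/subsetP => c /setIP[/setU1P[->|/setU1P[->|cS1]] cy] //; first exact: desc_trans mb.
by apply: (subsetP sb); rewrite inE cS1.
Qed.

(* A connected set Z avoiding an lca-closed S sees S through at most two nodes:
   the first element of S above Z and the topmost one below. *)
Lemma lca_closed_gates S Z : lca_closed S -> conn Z -> Z != set0 -> [disjoint Z & S] ->
  exists x1 x2, forall Z', conn Z' -> ~~ [disjoint Z & Z'] -> ~~ [disjoint Z' & S] ->
    (x1 \in Z') || (x2 \in Z').
Proof.
move=> cl cZ /set0Pn[z zZ] dZS; have nZS x : x \in Z -> x \notin S.
  by move=> xZ; apply: contraTN dZS => xS; apply/pred0Pn; exists x; rewrite /= xZ.
(* [A] consists of the nodes reached by climbing from [z] while avoiding [S]. The parent of the
   highest one, [y], is in [S] unless [y] is a root. *)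
pose A := [set y | (z \in D y) && [forall q, (z \in D q) && (q \in D y) ==> (q \notin S)]].
have zA : z \in A.
  rewrite inE desc_refl /=; apply/forallP => q; apply/implyP => /andP[zq qz].
  by rewrite -(desc_anti zq qz) nZS.
have [y yA my] := arg_minnP dep zA.
have : y \in A by [].
rewrite inE => /andP[zy /forallP hy].
have gate : p y \in S \/ p y = y.
  have [pS|pS] := boolP (p y \in S); first by left.
  right; have [//|lt] := rT.1 y.
  have /my : p y \in A; last by rewrite /= leqNgt lt.
  rewrite inE (desc_trans zy (desc_parent _ _)) /=; apply/forallP => q; apply/implyP => /andP[zq qy].
  have [qy'|yq] := desc_laminar zq zy; first by apply: (implyP (hy q)); rewrite zq.
  have [<-|yq'] := eqVneq y q; first by apply: (implyP (hy y)); rewrite zy desc_refl.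
  by rewrite (desc_anti qy (desc_step yq yq')).
have ZD : Z \subset D y.
  apply: conn_sub_desc_parent cZ zZ zy _; case: gate => [h|]; [left|by right].
  by apply/negP => /nZS; rewrite h.
have [b hb] : exists b, forall a, a \in S -> a \in D y -> [/\ b \in S, b \in D y & a \in D b].
  have [E|[a]] := set_0Vmem (S :&: D y).
    (* No member of [S] lies below [y], and the default [y] works vacuously. *)
    exists y => a aS ay; have : a \in S :&: D y by rewrite inE aS ay.
    by rewrite E inE.
  move=> /setIP[aS ay]; have [b [bS by' sb]] := cl y a aS ay.
  by exists b => c cS cy; split => //; apply: (subsetP sb); rewrite inE cS.
exists (p y), b => Z' cZ' /pred0Pn[x0 /andP[/= x0Z x0Z']] /pred0Pn[x1 /andP[/= x1Z' x1S]].
have [//|pZ'] := boolP (p y \in Z'); rewrite /=.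
have sZ' : Z' \subset D y.
  by apply: conn_sub_desc_parent cZ' x0Z' (subsetP ZD _ x0Z) _; left.
have [bS bD x1b] := hb x1 x1S (subsetP sZ' _ x1Z').
(* If [Z'] avoids [b] as well, first [Z'] and then [Z] lie below [b], so the climb from [z] to [y]
   meets [b], a member of [S]. *)
apply: contraT => bZ'.
have /subsetP/(_ _ x0Z') x0b := conn_sub_desc rT cZ' x1Z' x1b bZ'.
have bZ : b \notin Z by apply: contraL bS; exact: nZS.
have /subsetP/(_ _ zZ) zb := conn_sub_desc rT cZ x0Z x0b bZ.
by move: (implyP (hy b)); rewrite zb bD bS; apply.
Qed.

End Closure.

(** * The Erdős-Pósa property of connected sets in a tree decomposition *)

Section ErdosPosa.
Variables (G T : sgraph) (B : T -> {set G}) (p : T -> T) (dep : T -> nat).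
Hypothesis tB : tree_decomposition B.
Hypothesis rT : rooted p dep.
Implicit Types (F X Y : {set G}) (x y : T) (v w : G).

Definition nodes F := [set x | ~~ [disjoint B x & F]].

Lemma nodesP F x : reflect (exists2 v, v \in B x & v \in F) (x \in nodes F).
Proof.
rewrite inE; apply: (iffP pred0Pn) => [[v /andP[]]|[v v1 v2]]; exists v => //.
by rewrite /= v1.
Qed.

Lemma vertex_nodes_conn v : conn [set x | v \in B x].
Proof. by case: tB => _ _ _ h; apply/connP. Qed.

(** The nodes containing a fixed vertex are connected, and adjacent vertices of [F] share a bag. *)
Lemma nodes_conn F : conn F -> conn (nodes F).
Proof.
move=> cF; have [->|[x xF]] := set_0Vmem (nodes F); first exact: conn0.
have /nodesP[v vx vF] := xF.
apply: (@conn_hub _ _ x) => y /nodesP[w wy wF].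
have sub u : u \in F -> [set x | u \in B x] \subset nodes F.
  by move=> uF; apply/subsetP => z; rewrite inE => uz; apply/nodesP; exists u.
have fibre u z z' : u \in F -> u \in B z -> u \in B z' -> connect (inrel (nodes F)) z z'.
  move=> uF uz uz'; apply: connect_inrelS (sub u uF) _.
  by move/connP: (vertex_nodes_conn u); apply; rewrite inE.
pose A := [pred u | [forall y, (u \in B y) ==> connect (inrel (nodes F)) x y]].
suff: w \in A by move=> /forallP/(_ y)/implyP; apply.
apply: (conn_ind cF vF) wF => [|u u' uF u'F uu' /forallP hu].
  by apply/forallP => z; apply/implyP => vz; apply: fibre vx vz.
apply/forallP => z; apply/implyP => u'z.
have [_ _ hE _] := tB; have [z0 /andP[uz0 u'z0]] := hE _ _ uu'.
exact: connect_trans (implyP (hu z0) uz0) (fibre u' _ _ u'F u'z0 u'z).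
Qed.

Lemma nodes_neq0 F : F != set0 -> nodes F != set0.
Proof.
case/set0Pn => v vF; have [_ h _ _] := tB; have [x vx] := h v.
by apply/set0Pn; exists x; apply/nodesP; exists v.
Qed.

(* Greedy choice of a member F whose subtree has the deepest top x: a member avoiding the bag of x is disjoint from F. *)
Lemma erdos_posa (P : pred {set G}) :
  (forall F, P F -> conn F /\ F != set0) ->
  exists (S : {set T}) (FF : {set {set G}}),
    [/\ #|S| <= #|FF|, trivIset FF, (forall F, F \in FF -> P F) &
        forall F, P F -> ~~ [disjoint nodes F & S]].
Proof.
have [n] := ubnP #|[set F | P F]|; elim: n P => // n IH P ltn hP.
(* Each member of the family is paired with the top of its subtree. *)
pose Q := [set q : {set G} * T | [&& P q.1, q.2 \in nodes q.1 & nodes q.1 \subset desc p q.2]].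
have topQ F : P F -> exists x, (F, x) \in Q.
  move=> PF; have [cF F0] := hP F PF.
  have [x xF sF] := conn_top rT (nodes_conn cF) (nodes_neq0 F0).
  by exists x; rewrite inE PF xF.
have [Q0|[q0 q0Q]] := set_0Vmem Q.
  exists set0, set0; split; rewrite ?cards0 //.
  - by apply/trivIsetP => X Y; rewrite inE.
  - by move=> F; rewrite inE.
  - by move=> F /topQ[x]; rewrite Q0 inE.
have [[F x] FQ mx] := arg_maxnP (fun q => dep q.2) q0Q.
have : (F, x) \in Q by [].
rewrite inE /= => /and3P[PF xF sF].
pose P' := [pred F' | P F' && (x \notin nodes F')].
have [||S [FF [cS tFF hFF hit]]] := IH P'.
- apply: (@leq_trans #|[set F | P F]|); last by rewrite -ltnS.
  apply: proper_card; apply/properP; split.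
    by apply/subsetP => F'; rewrite !inE => /andP[].
  by exists F; rewrite inE ?PF //= xF andbF.
- by move=> F' /andP[/hP].
have dis F' : F' \in FF -> [disjoint F & F'].
  move=> /hFF /andP[PF' xF']; apply: contraR xF' => /pred0Pn[v /andP[/= vF vF']].
  have [x' x'Q] := topQ F' PF'; move: (mx _ x'Q) => /= le.
  move: x'Q; rewrite inE /= => /and3P[_ x'F' _].
  have [_ h _ _] := tB; have [z vz] := h v; have [cF' _] := hP F' PF'.
  by apply: (conn_meet_top rT (nodes_conn cF') sF x'F' le (z := z)); apply/nodesP; exists v.
have F0 : F != set0 by have [] := hP F PF.
have nF : F \notin FF.
  by apply/negP => /dis; rewrite -setI_eq0 setIid (negPf F0).
exists (x |: S), (F |: FF); split.
- rewrite !cardsU1 nF; move: cS; case: (_ \notin _); move: #|S| #|FF| => a b; clear; lia.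
- move/trivIsetP: tFF => tFF; apply/trivIsetP => X Y /setU1P[->|XF] /setU1P[->|YF] XY; auto.
    by rewrite eqxx in XY.
  by rewrite disjoint_sym dis.
- by move=> F' /setU1P[->//|/hFF /andP[]].
- move=> F' PF'; have [xF'|xF'] := boolP (x \in nodes F').
    by apply/pred0Pn; exists x; rewrite /= xF' setU11.
  have /hit : P' F' by rewrite /= PF'.
  by case/pred0Pn => y /andP[/= h1 h2]; apply/pred0Pn; exists y; rewrite /= h1 inE h2 orbT.
Qed.

End ErdosPosa.

Lemma card_fibres (I J : finType) (A : {set I}) (f : I -> J) m :
  (forall c, #|[set x in A | f x == c]| <= m) -> #|A| <= #|f @: A| * m.
Proof.
move=> h; rewrite -sum1_card (partition_big f (mem (f @: A))) /=; last by move=> x xA; apply: imset_f.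
rewrite -sum_nat_const; apply: leq_sum => c _; rewrite sum1_card; apply: leq_trans (h c).
by apply/subset_leq_card/subsetP => x; rewrite !inE.
Qed.

Lemma minor_of_branch_sets (G : sgraph) s t (XX YY : {set {set G}}) :
  #|XX| = s -> #|YY| = t -> branch_sets (XX :|: YY) -> [disjoint XX & YY] ->
  (forall X Y, X \in XX -> Y \in YY -> touch X Y) -> minor (K_bip s t) G.
Proof.
move=> <- <- /branch_setsP[h1 h2 h3] dis tch.
pose phi (z : K_bip #|XX| #|YY|) : {set G} := match z with inl i => enum_val i | inr j => enum_val j end.
have inU z : phi z \in XX :|: YY.
  by case: z => i; rewrite inE (enum_valP i) ?orbT.
have nXY X : X \in XX -> X \in YY -> False.
  by move=> XX' XY; case/pred0Pn: dis; exists X; rewrite /= XX'.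
exists phi; split.
- by move=> z; apply: h2.
- move=> x y xy; apply: h1 => //; apply: contraNneq xy.
  case: x y => i [] j /= E; apply/eqP.
  + by congr inl; apply: enum_val_inj.
  + by case: (nXY _ (enum_valP i)); rewrite E enum_valP.
  + by case: (nXY _ (enum_valP j)); rewrite -E enum_valP.
  + by congr inr; apply: enum_val_inj.
- by move=> z; apply/connP/h3.
- case=> i [] j //= _.
    have /touchP[v [w [vX wY vw]]] := tch _ _ (enum_valP i) (enum_valP j).
    by exists v, w; rewrite vX wY.
  have /touchP[v [w [vX wY vw]]] := tch _ _ (enum_valP j) (enum_valP i).
  by exists w, v; rewrite vX wY sadj_sym.
Qed.

(** * Choosing the next part inside a component *)

Section Step.
Variables (G T : sgraph) (B : T -> {set G}) (p : T -> T) (dep : T -> nat) (s t K : nat).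
Hypothesis tB : tree_decomposition B.
Hypothesis rT : rooted p dep.
Hypothesis cardB : forall x, #|B x| <= K.
Hypothesis freeG : Kst_minor_free s t G.
Hypothesis t0 : 0 < t.
Implicit Types (F W Y Q : {set G}) (v w c d : G) (S : {set T}).

Definition nbh F := [set w | [exists v in F, sadj v w]].

Lemma nbhP F w : reflect (exists2 v, v \in F & sadj v w) (w \in nbh F).
Proof. by rewrite inE; apply: exists_inP. Qed.

Lemma nbhS F F' : F \subset F' -> nbh F \subset nbh F'.
Proof.
move=> /subsetP sF; apply/subsetP => w /nbhP[v /sF vF vw]; by apply/nbhP; exists v.
Qed.

Definition bags S := \bigcup_(x in S) B x.

Lemma card_bags S : #|bags S| <= #|S| * K.
Proof.
rewrite -sum_nat_const /bags; elim/big_rec2: _ => [|x n A _ IH]; first by rewrite cards0.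
by rewrite (leq_trans (leq_card_setU _ _)) // leq_add.
Qed.

Lemma bagsP S v : reflect (exists2 x, x \in S & v \in B x) (v \in bags S).
Proof. exact: bigcupP. Qed.

(** The subtree of a counted neighbour meets both [nodes B F] and [S], so it passes through one of
    two gates; the neighbour therefore lies in one of two bags. *)
Lemma lca_closed_nbh S F : lca_closed p S -> conn F -> F != set0 -> [disjoint F & bags S] ->
  #|nbh F :&: bags S| <= 2 * K.
Proof.
move=> cl cF F0 dF.
have dis : [disjoint nodes B F & S].
  apply/pred0Pn => -[x /andP[/= /nodesP[v vx vF] xS]]; case/pred0Pn: dF.
  by exists v; rewrite /= vF; apply/bagsP; exists x.
have [x1 [x2 h]] := lca_closed_gates rT cl (nodes_conn tB cF) (nodes_neq0 tB F0) dis.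
have sub : nbh F :&: bags S \subset B x1 :|: B x2.
  apply/subsetP => w /setIP[/nbhP[v vF vw] /bagsP[x xS wx]]; rewrite inE.
  have := h _ (vertex_nodes_conn tB w); rewrite !inE; apply.
    have [_ _ hE _] := tB; have [z /andP[vz wz]] := hE _ _ vw.
    by apply/pred0Pn; exists z; rewrite /= inE wz andbT; apply/nodesP; exists v.
  by apply/pred0Pn; exists x; rewrite /= inE wx.
apply: leq_trans (subset_leq_card sub) _; apply: leq_trans (leq_card_setU _ _) _.
by rewrite mul2n -addnn leq_add.
Qed.

Variables (W : {set G}) (col : G -> G).

(** [W] is the set of vertices already placed and [col] names the part of each; these are the parts
    seen from [F]. *)
Definition touched F := col @: (nbh F :&: W).

Lemma touchedP F c :
  reflect (exists v w, [/\ v \in F, w \in W, sadj v w & c = col w]) (c \in touched F).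
Proof.
apply: (iffP imsetP) => [[w /setIP[/nbhP[v vF vw] wW] ->]|[v [w [vF wW vw ->]]]].
  by exists v, w.
by exists w => //; rewrite inE wW andbT; apply/nbhP; exists v.
Qed.

Lemma touchedS F F' : F \subset F' -> touched F \subset touched F'.
Proof. by move=> sF; apply/imsetS/setSI/nbhS. Qed.

(** The threshold of [dense_bipartite_minor] when one side consists of the at most [2 * K] visible
    vertices of each of [s] parts. *)
Definition part_number := s`! * t * (s * (2 * K)).+1.

Lemma part_number_gt0 : 0 < part_number.
Proof. by rewrite !muln_gt0 fact_gt0 t0. Qed.

Lemma hitting_nodes Y : conn Y -> Y != set0 -> [disjoint Y & W] ->
  #|touched Y| <= s -> (forall c, #|[set w in nbh Y :&: W | col w == c]| <= 2 * K) ->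
  exists S, [/\ #|S| <= part_number, ~~ [disjoint nodes B Y & S] &
    forall F, conn F -> F != set0 -> F \subset Y -> [disjoint nodes B F & S] -> #|touched F| < s].
Proof.
move=> cY Y0 dYW; rewrite leq_eqVlt => /orP[/eqP tY|ltY] few; last first.
  (* With fewer than [s] parts touched nothing has to be hit; one node of [Y] is taken so that the
     next part will be nonempty. *)
  have /set0Pn[x xY] := nodes_neq0 tB Y0.
  exists [set x]; split; first by rewrite cards1 part_number_gt0.
    by apply/pred0Pn; exists x; rewrite /= xY set11.
  by move=> F _ _ /touchedS/subset_leq_card sF _; apply: leq_ltn_trans ltY.
pose P := [pred F : {set G} | [&& conn F, F != set0, F \subset Y & touched F == touched Y]].
have [|S [FF [cS tFF hFF hit]]] := @erdos_posa _ _ B _ _ tB rT P.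
  by move=> F /and4P[].
exists S; split; last 2 first.
- by apply: hit; rewrite /= cY Y0 subxx eqxx.
- move=> F cF F0 sF dF; rewrite ltn_neqAle; apply/andP; split; last first.
    by rewrite -tY subset_leq_card // touchedS.
  apply: contraL dF => /eqP tF; apply: hit; rewrite /= cF F0 sF /=.
  by rewrite eqEcard touchedS // tF tY leqnn.
apply: leq_trans cS _; rewrite leqNgt; apply/negP => big; apply: freeG.
(* One side consists of singletons, the other of the disjoint sets in [FF]. For [c] in [touched Y],
   [rep F c] is a vertex of part [c] adjacent to [F], and the default is never returned. Distinct
   parts give distinct representatives, so [N F] has [s] members. *)
pose A := [set [set w] | w in nbh Y :&: W].
pose rep F c := odflt c [pick w | [&& w \in nbh F, w \in W & col w == c]].
pose N F := [set [set rep F c] | c in touched Y].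
have repP F c : F \in FF -> c \in touched Y -> [&& rep F c \in nbh F, rep F c \in W & col (rep F c) == c].
  move=> /hFF/and4P[_ _ _ /eqP <-] /touchedP[v [w [vF wW vw ->]]].
  have wF : w \in nbh F by apply/nbhP; exists v.
  by rewrite /rep; case: pickP => [//|/(_ w)]; rewrite wF wW eqxx.
have sFY F : F \in FF -> F \subset Y by move=> /hFF/and4P[].
have YW v : v \in Y -> v \in W -> False.
  by move=> vY vW; case/pred0Pn: dYW; exists v; rewrite /= vY.
have bAF : branch_sets (A :|: FF).
  have dAF w F : w \in W -> F \in FF -> [disjoint [set w] & F].
    by move=> wW FFF; rewrite disjoints1; apply/negP => /(subsetP (sFY F FFF))/YW/(_ wW).
  apply/branch_setsP; split.
  - move=> X Z /setUP[/imsetP[w /setIP[_ wW] ->]|XF] /setUP[/imsetP[w' /setIP[_ w'W] ->]|ZF] XZ; auto.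
    + by rewrite disjoints1 inE; apply: contraNneq XZ => ->.
    + by rewrite disjoint_sym; auto.
    + by move/trivIsetP: tFF; apply.
  - move=> X /setUP[/imsetP[w _ ->]|/hFF/and4P[]//].
    by apply/set0Pn; exists w; rewrite set11.
  - by move=> X /setUP[/imsetP[w _ ->]|/hFF/and4P[]//]; apply: conn1.
have disAF : [disjoint A & FF].
  apply/pred0Pn => -[X /andP[/= /imsetP[w /setIP[_ wW] ->]]] /sFY; by rewrite sub1set => /YW/(_ wW).
have adN : adapted s A FF N.
  move=> F FFF; split.
  - apply/subsetP => X /imsetP[c cT ->]; have /and3P[r1 r2 _] := repP F c FFF cT.
    by apply: imset_f; rewrite inE r2 (subsetP (nbhS (sFY F FFF))).
  - rewrite -tY card_in_imset // => c c' cT c'T /set1_inj E.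
    have /and3P[_ _ /eqP e1] := repP F c FFF cT; have /and3P[_ _ /eqP e2] := repP F c' FFF c'T.
    by rewrite -e1 -e2 E.
  - move=> X /imsetP[c cT ->]; have /and3P[/nbhP[v vF vr] _ _] := repP F c FFF cT.
    by apply/touchP; exists (rep F c), v; rewrite set11 sadj_sym.
have [|XX [YY [h1 h2 _ [h3 h4 _ h5]]]] := dense_bipartite_minor t0 bAF disAF adN.
  apply: leq_trans (ltnW big); rewrite leq_mul2l ltnS; apply/orP; right.
  apply: leq_trans (leq_imset_card _ _) _; rewrite -tY.
  exact: card_fibres.
exact: minor_of_branch_sets h1 h2 h3 h4 h5.
Qed.

(** The closure at most doubles the number of nodes, and each bag has at most [K] vertices. *)
Definition width_bound := 2 * part_number * K.

(** The part is the trace on [Y] of the bags of the closed hitting set. The strict inequality leaves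
    room for [Q] itself among the at most [s] parts touched by [F]. *)
Lemma next_part Y : conn Y -> Y != set0 -> [disjoint Y & W] ->
  #|touched Y| <= s -> (forall c, #|[set w in nbh Y :&: W | col w == c]| <= 2 * K) ->
  exists Q, [/\ Q \subset Y, Q != set0, #|Q| <= width_bound &
    forall F, conn F -> F != set0 -> F \subset Y -> [disjoint F & Q] ->
      #|touched F| < s /\ #|nbh F :&: Q| <= 2 * K].
Proof.
move=> cY Y0 dY tY few; have [S0 [cS0 hS0 hit]] := hitting_nodes cY Y0 dY tY few.
have [S [sS cS cl]] := lca_closure rT S0.
exists (bags S :&: Y); split.
- exact: subsetIr.
- case/pred0Pn: hS0 => x /andP[/= /nodesP[v vx vY] xS]; apply/set0Pn; exists v.
  by rewrite inE vY andbT; apply/bagsP; exists x => //; apply: (subsetP sS).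
- apply: leq_trans (subset_leq_card (subsetIl _ _)) _; apply: leq_trans (card_bags _) _.
  by rewrite leq_mul2r (leq_trans cS) ?orbT // leq_mul2l cS0.
- move=> F cF F0 sF dF.
  have dFS : [disjoint F & bags S].
    apply: contraTT dF => /pred0Pn[v /andP[/= vF vS]]; apply/pred0Pn; exists v.
    by rewrite /= vF inE vS (subsetP sF).
  split.
    apply: hit => //; apply/pred0Pn => -[x /andP[/= /nodesP[v vx vF] xS]].
    case/pred0Pn: dFS; exists v; rewrite /= vF; apply/bagsP; exists x => //; exact: (subsetP sS).
  apply: leq_trans (lca_closed_nbh cl cF F0 dFS).
  by apply/subset_leq_card/setIS/subsetIl.
Qed.

End Step.

(** * Treewidth from an elimination ordering *)

Section EliminationTree.
Variables (H : sgraph) (rk : H -> nat) (up : H -> {set H}) (c : nat).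
Hypothesis card_up : forall v, #|up v| <= c.
Hypothesis rk_up : forall v u, u \in up v -> rk u < rk v.
Hypothesis clique_up : forall v u w, u \in up v -> w \in up v -> u != w -> u \in up w \/ w \in up u.
Hypothesis edge_up : forall u v, sadj u v -> u \in up v \/ v \in up u.

(** The latest member of [up v]. The value [None] is an additional root that joins the forest of
    parents into one tree. *)
Definition parent v : option H :=
  omap (fun u0 => [arg max_(u > u0 in up v) rk u]) [pick u in up v].

Variant parent_spec v : option H -> Prop :=
  | ParentNone of up v = set0 : parent_spec v None
  | ParentSome u of u \in up v & (forall w, w \in up v -> rk w <= rk u) : parent_spec v (Some u).

Lemma parentP v : parent_spec v (parent v).
Proof.
rewrite /parent; case: pickP => [u0 u0v|h] /=; last first.
  by apply: ParentNone; apply/setP => u; rewrite h inE.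
by case: arg_maxnP => // u uv mu; apply: ParentSome.
Qed.

Definition parent_adj : rel (option H) := fun a b =>
  (if a is Some v then parent v == b else false) || (if b is Some v then parent v == a else false).

Lemma parent_adj_sym : symmetric parent_adj.
Proof. by move=> a b; rewrite /parent_adj orbC. Qed.

Lemma parent_adj_irrefl : irreflexive parent_adj.
Proof.
case=> // v; rewrite /parent_adj orbb; case: parentP => // u /rk_up lt _.
by apply/eqP => -[e]; rewrite e ltnn in lt.
Qed.

Definition parent_tree := SGraph parent_adj_sym parent_adj_irrefl.

(** Ranks decrease towards the root, so every vertex reaches [None], and each edge arises from
    exactly one vertex and its parent. *)
Lemma parent_tree_is_tree : is_tree parent_tree.
Proof.
have root (x : parent_tree) : connect (@sadj parent_tree) None x.
  case: x => [v|]; last exact: connect0.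
  have [n] := ubnP (rk v); elim: n v => // n IH v ltn.
  have e : sadj (parent v : parent_tree) (Some v) by rewrite /= /parent_adj eqxx orbT.
  apply: connect_trans (connect1 e); case: parentP => [_|u uv _]; first exact: connect0.
  by apply: IH; apply: leq_trans (rk_up uv) _; rewrite -ltnS.
split; first by apply/card_gt0P; exists None.
split.
  move=> x y; apply: connect_trans (root y).
  rewrite sym_connect_sym; [exact: root | exact: sadj_sym].
rewrite /nedges; have -> : #|parent_tree| = #|H|.+1 by rewrite card_option.
rewrite subn1 /=.
pose f v : option H * option H := (Some v, parent v); pose g v : option H * option H := (parent v, Some v).
have -> : [set q : parent_tree * parent_tree | sadj q.1 q.2] = (f @: [set: H]) :|: (g @: [set: H]).
  apply/setP => -[a b]; rewrite !inE /= /parent_adj; apply/orP/orP => -[].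
  - by case: a => // v /eqP <-; left; apply: imset_f.
  - by case: b => // v /eqP <-; right; apply: imset_f.
  - by case/imsetP => v _ [-> ->]; left.
  - by case/imsetP => v _ [-> ->]; right.
have dis : [disjoint f @: [set: H] & g @: [set: H]].
  apply/pred0P => q /=; apply/negP => /andP[/imsetP[a _ ->] /imsetP[b _ [+ +]]].
  case: (parentP a) => // u /rk_up lt1 _; case: (parentP b) => // w /rk_up lt2 _.
  by move=> [e1] [e2]; move: lt1 lt2; rewrite e1 e2 => h; rewrite ltnNge (ltnW h).
have := cardsUI (f @: [set: H]) (g @: [set: H]).
rewrite (disjoint_setI0 dis) cards0 addn0 => ->.
rewrite !card_imset => [|a b [_ ->]//|a b [->]//].
by rewrite cardsT addnn divn2 doubleK.
Qed.

Definition parent_bag (x : parent_tree) : {set H} := if x is Some v then v |: up v else set0.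

Lemma tw_le_elimination : tw_le H c.
Proof.
exists parent_tree, parent_bag; split; last first.
  case=> [v|] /=; last by rewrite cards0.
  rewrite cardsU1; apply: (leq_trans (n := 1 + c)); last by [].
  by apply: leq_add; [case: (_ \notin _)|].
split; first exact: parent_tree_is_tree.
- by move=> v; exists (Some v); rewrite /= setU11.
- move=> v w /edge_up[h|h]; [exists (Some w)|exists (Some v)]; by rewrite /= setU11 setU1r.
- move=> w; apply/connP; pose X : {set parent_tree} := [set x | w \in parent_bag x].
  apply: (@conn_hub _ _ (Some w : parent_tree)) => -[v|]; last by rewrite !inE.
  rewrite inE /= => /setU1P[<-//|].
  have [n] := ubnP (rk v); elim: n v => // n IH v ltn wv.
  have e : sadj (parent v : parent_tree) (Some v) by rewrite /= /parent_adj eqxx orbT.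
  move: e; case: parentP => [E _|u uv mu e]; first by rewrite E inE in wv.
  have vX : (Some v : parent_tree) \in X by rewrite inE /= setU1r.
  have [E|nuw] := eqVneq u w.
    by subst u; apply: connect1; rewrite inrelE e vX inE /= setU11.
  (* The parent [u] has the largest rank in [up v], so the clique condition puts the other members
     of [up v] into [up u]; the walk up the tree keeps [w] in every bag until it reaches [w]. *)
  have wu : w \in up u.
    by have [/rk_up|//] := clique_up uv wv nuw; rewrite ltnNge mu.
  have uX : (Some u : parent_tree) \in X by rewrite inE /= setU1r.
  apply: (connect_trans (IH u _ wu)); first by apply: leq_trans (rk_up uv) _; rewrite -ltnS.
  by apply: connect1; rewrite inrelE e uX vX.
Qed.

End EliminationTree.

(** * Building the partition part by part *)

Section Process.
Variables (G T : sgraph) (B : T -> {set G}) (p : T -> T) (dep : T -> nat) (s t K : nat).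
Hypothesis tB : tree_decomposition B.
Hypothesis rT : rooted p dep.
Hypothesis cardB : forall x, #|B x| <= K.
Hypothesis freeG : Kst_minor_free s t G.
Hypothesis t0 : 0 < t.
Implicit Types (F W Y Q : {set G}) (v w c d : G).

(* A part is named by one of its vertices; [up c] is the set of earlier parts adjacent to the part c. *)
Record partial_partition W (col : G -> G) (up : G -> {set G}) (rk : G -> nat) : Prop := PartialPartition {
  pp_col : forall v, v \in W -> col v \in W;
  pp_card : forall c, #|up c| <= s;
  pp_rk : forall c d, d \in up c -> rk d < rk c;
  pp_clique : forall c d e, d \in up c -> e \in up c -> d != e -> d \in up e \/ e \in up d;
  pp_up : forall c d, d \in up c -> d \in W;
  pp_rkW : forall v, v \in W -> rk (col v) < #|W|;
  pp_edge : forall v w, v \in W -> w \in W -> sadj v w ->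
    [\/ col v = col w, col v \in up (col w) | col w \in up (col v)];
  pp_width : forall c, #|[set v in W | col v == c]| <= width_bound s t K;
  pp_front : forall F, conn F -> F != set0 -> [disjoint F & W] ->
    [/\ #|touched W col F| <= s,
        forall d e, d \in touched W col F -> e \in touched W col F -> d != e -> d \in up e \/ e \in up d &
        forall c, #|[set w in nbh F :&: W | col w == c]| <= 2 * K] }.

(** [Y] is a component of the graph outside [W], obtained as a maximal connected set; the last
    clause is its maximality. *)
Lemma maximal_conn W v : v \notin W ->
  exists Y, [/\ conn Y, Y != set0, [disjoint Y & W] &
    forall F, conn F -> [disjoint F & W] -> ~~ [disjoint F & Y] \/ touch F Y -> F \subset Y].
Proof.
move=> vW; pose P (S : {set G}) := conn S && [disjoint S & W].
have Pv : P [set v] by rewrite /P conn1 disjoints1.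
have [Y /maxsetP[/andP[cY dY] mY] vY] := maxset_exists Pv.
exists Y; split => //; first by apply/set0Pn; exists v; rewrite (subsetP vY) ?set11.
move=> F cF dF h; rewrite -(mY (F :|: Y)) ?subsetUl ?subsetUr //.
rewrite /P disjointUl dF dY !andbT.
by case: h => h; [apply: conn_meetU|apply: connU].
Qed.

(** The new part [Q] lies in a component [Y] outside [W], and its earlier neighbours are the parts
    touched by [Y]. A connected set avoiding [W] and [Q] either lies in [Y], where [next_part]
    controls it, or sees nothing of [Q], so that its old bounds persist. *)
Lemma extend_partition W col up rk v : v \notin W -> partial_partition W col up rk ->
  exists W' col' up' rk', W \proper W' /\ partial_partition W' col' up' rk'.
Proof.
move=> vW [ppcol ppcard pprk ppcl ppup pprkW ppedge ppw ppf].
have [Y [cY Y0 dY mY]] := maximal_conn vW.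
have [tY clY fewY] := ppf Y cY Y0 dY.
have [Q [QY Q0 cQ front]] := next_part tB rT cardB freeG t0 cY Y0 dY tY fewY.
have /set0Pn[q qQ] := Q0.
have QW w : w \in Q -> w \notin W.
  by move=> /(subsetP QY) wY; apply: contraTN dY => wW; apply/pred0Pn; exists w; rewrite /= wY.
have Wq c : c \in W -> c == q = false.
  by move=> cW; apply/eqP => e; move: (QW _ qQ); rewrite -e cW.
have WQ w : w \in W -> w \in Q = false by move=> wW; apply/negP => /QW; rewrite wW.
have tW F c : c \in touched W col F -> c \in W.
  by move=> /touchedP[_ [w [_ wW _ ->]]]; apply: ppcol.
pose col' w := if w \in Q then q else col w.
pose up' c := if c == q then touched W col Y else up c.
(* By [pp_rkW] the rank [#|W|] is above that of every existing part. *)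
pose rk' c := if c == q then #|W| else rk c.
have upW c : c \in W -> up' c = up c by move=> cW; rewrite /up' Wq.
have rkW c : c \in W -> rk' c = rk c by move=> cW; rewrite /rk' Wq.
have colW w : w \in W -> col' w = col w by move=> wW; rewrite /col' WQ.
have colQ w : w \in Q -> col' w = q by rewrite /col' => ->.
have upq : up' q = touched W col Y by rewrite /up' eqxx.
have rkq : rk' q = #|W| by rewrite /rk' eqxx.
have prW : W \proper W :|: Q.
  by apply/properP; split; [exact: subsetUl|exists q; rewrite ?QW // inE qQ orbT].
exists (W :|: Q), col', up', rk'; split => //; split.
- move=> w /setUP[wW|wQ]; first by rewrite colW // inE ppcol.
  by rewrite colQ // inE qQ orbT.
- by move=> c; rewrite /up'; case: ifP.
- move=> c d; rewrite {1}/up'; case: eqP => [->|/eqP cq] dc.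
    have dW := tW _ _ dc; rewrite rkq rkW //.
    by case/touchedP: dc => _ [w [_ wW _ ->]]; apply: pprkW.
  by rewrite rkW ?(ppup _ _ dc) // /rk' (negPf cq) pprk.
- move=> c d e; rewrite {1 2}/up'; case: eqP => [_|_] h1 h2 de.
    by rewrite !upW ?(tW Y) //; apply: clY.
  by rewrite !upW ?(ppup c) //; apply: ppcl h1 h2 de.
- move=> c d; rewrite /up'; case: eqP => [_ /tW|_ /ppup] h; by rewrite inE h.
- move=> w /setUP[wW|wQ].
    by rewrite colW // rkW ?ppcol // (leq_trans (pprkW w wW)) // ltnW // proper_card.
  by rewrite colQ // rkq proper_card.
- move=> w w' /setUP[wW|wQ] /setUP[w'W|w'Q] ww'.
  + by rewrite !colW // !upW ?ppcol //; apply: ppedge.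
  + rewrite colW // (colQ w') // upq; apply: Or32; apply/touchedP; exists w', w.
    by rewrite sadj_sym (subsetP QY).
  + rewrite (colW w') // (colQ w) // upq; apply: Or33; apply/touchedP; exists w, w'.
    by rewrite (subsetP QY).
  + by apply: Or31; rewrite !colQ.
- move=> c; have [->|cq] := eqVneq c q.
    apply: leq_trans cQ; apply/subset_leq_card/subsetP => w; rewrite !inE => /andP[/orP[wW|//]].
    by rewrite colW // Wq // ppcol.
  apply: leq_trans (ppw c); apply/subset_leq_card/subsetP => w; rewrite !inE => /andP[/orP[wW|wQ]].
    by rewrite colW // wW.
  by rewrite colQ // eq_sym (negPf cq).
- move=> F cF F0 dF.
  have dFW : [disjoint F & W] by apply: disjointWr dF; apply: subsetUl.
  have dFQ : [disjoint F & Q] by apply: disjointWr dF; apply: subsetUr.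
  have [tF clF fewF] := ppf F cF F0 dFW.
  have FY : F \subset Y \/ nbh F :&: Q = set0.
    have [->|[w /setIP[/nbhP[u uF uw] wQ]]] := set_0Vmem (nbh F :&: Q); first by right.
    left; apply: mY => //; right; apply/touchP; exists u, w; by rewrite (subsetP QY).
  have tF' d : d \in touched (W :|: Q) col' F -> (d = q /\ F \subset Y) \/ d \in touched W col F.
    move=> /touchedP[u [w [uF /setUP[wW|wQ] uw ->]]].
      by right; rewrite colW //; apply/touchedP; exists u, w.
    rewrite colQ //; left; split => //; case: FY => // E.
    have : w \in nbh F :&: Q by rewrite inE wQ andbT; apply/nbhP; exists u.
    by rewrite E inE.
  split.
  + have [FsY|nFY] := boolP (F \subset Y).
      have [lt _] := front F cF F0 FsY dFQ.
      apply: leq_trans lt; apply: (@leq_trans #|q |: touched W col F|).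
        by apply/subset_leq_card/subsetP => d /tF'[[-> _]|h]; [exact: setU11|exact: setU1r].
      by rewrite cardsU1 -add1n leq_add2r; case: (_ \notin _).
    apply: leq_trans tF; apply/subset_leq_card/subsetP => d /tF'[[_ FY']|//].
    by rewrite FY' in nFY.
  + move=> d e /tF'[[-> sF]|dF'] /tF'[[-> sF']|eF] de.
    * by rewrite eqxx in de.
    * by right; rewrite upq (subsetP (touchedS W col sF)).
    * by left; rewrite upq (subsetP (touchedS W col sF')).
    * by rewrite !upW ?(tW F) //; apply: clF.
  + move=> c; have [->|cq] := eqVneq c q.
      case: FY => [sF|E].
        have [_ le] := front F cF F0 sF dFQ; apply: leq_trans le.
        apply/subset_leq_card/subsetP => w; rewrite inE => /andP[/setIP[wF /setUP[wW|wQ]]].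
          by rewrite colW // Wq // ppcol.
        by rewrite in_setI wF.
      rewrite (_ : [set _ | _] = set0) ?cards0 //; apply/setP => w; rewrite inE [in RHS]inE.
      apply/negP => /andP[/setIP[wF /setUP[wW|wQ]]]; first by rewrite colW // Wq // ppcol.
      have : w \in nbh F :&: Q by rewrite in_setI wF.
      by rewrite E inE.
    apply: leq_trans (fewF c); apply/subset_leq_card/subsetP => w.
    rewrite inE => /andP[/setIP[wF /setUP[wW|wQ]]]; first by rewrite colW // inE in_setI wF wW.
    by rewrite colQ // eq_sym (negPf cq).
Qed.

Lemma full_partition : exists col up rk, partial_partition setT col up rk.
Proof.
have [n] := ubnP #|~: (set0 : {set G})|.
have : partial_partition set0 id (fun _ => set0) (fun _ => 0).
  split=> [v|c|c d|c d e|c d|v|v w|c|F _ _ _]; rewrite ?inE ?cards0 //.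
    by rewrite (_ : [set _ in _ | _] = set0) ?cards0 //; apply/setP => v; rewrite !inE.
  have t1 : touched set0 id F = set0.
    by apply/setP => c; rewrite inE; apply/negP => /touchedP[v [w []]]; rewrite inE.
  split=> [|d e|c]; rewrite ?t1 ?cards0 ?inE //.
  by rewrite (_ : [set _ in _ | _] = set0) ?cards0 //; apply/setP => v; rewrite !inE andbF.
move: (set0 : {set G}) id (fun _ => set0) (fun _ => 0).
elim: n => // n IH W col up rk pW ltn.
have [E|[v]] := set_0Vmem (~: W).
  by exists col, up, rk; rewrite -setC0 -E setCK.
rewrite inE => /extend_partition/(_ pW)[W' [col' [up' [rk' [WW' pW']]]]].
apply: IH pW' _; apply: leq_trans (_ : #|~: W| <= n); last by rewrite -ltnS.
by rewrite proper_card // properC.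
Qed.

(** The quotient graph keeps all of [G] as its vertex type; a vertex that names no part indexes an
    empty one. *)
Lemma tpw_le_width_bound : tpw_le s G (width_bound s t K).
Proof.
have [col [up [rk [_ h1 h2 h3 _ _ h4 h5 _]]]] := full_partition.
pose adj : rel G := fun c d => (c \in up d) || (d \in up c).
have adj_sym : symmetric adj by move=> c d; rewrite /adj orbC.
have adj_irr : irreflexive adj.
  by move=> c; rewrite /adj orbb; apply/negP => /h2; rewrite ltnn.
exists (SGraph adj_sym adj_irr), col; split.
  by apply: (@tw_le_elimination (SGraph adj_sym adj_irr) rk up) => // u v /orP.
split => [v w vw|c].
  have [->|h|h] := h4 v w (in_setT _) (in_setT _) vw; [by left| |]; right; by rewrite /= /adj h ?orbT.
by apply: leq_trans (h5 c); apply/subset_leq_card/subsetP => v; rewrite !inE.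
Qed.

End Process.

Lemma tw_le_tpw_le s t k (G : sgraph) : 0 < t -> Kst_minor_free s t G -> tw_le G k ->
  tpw_le s G (width_bound s t k.+1).
Proof.
move=> t0 fG [T [B [tB cB]]]; have [h _ _ _] := tB.
have [p [dep rT]] := tree_rooted h.
exact: tpw_le_width_bound tB rT cB fG t0.
Qed.

(** * Lower bound: cliques against treewidth *)

Lemma clique_card_tw (H : sgraph) c (Q : {set H}) :
  tw_le H c -> {in Q &, forall u v, u != v -> sadj u v} -> #|Q| <= c.+1.
Proof.
move=> [T [B [tB cB]]] clQ; have [h hV hE _] := tB.
have [p [dep rT]] := tree_rooted h.
pose S v := [set x | v \in B x].
have S0 v : S v != set0 by have [x vx] := hV v; apply/set0Pn; exists x; rewrite inE.
have [->|[q0 q0Q]] := set_0Vmem Q; first by rewrite cards0.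
have top v : exists x, (x \in S v) && (S v \subset desc p x).
  by have [x xS sx] := conn_top rT (vertex_nodes_conn tB v) (S0 v); exists x; rewrite xS.
pose tp v := xchoose (top v).
have tpP v : (tp v \in S v) && (S v \subset desc p (tp v)) := xchooseP (top v).
(* The subtrees of a clique meet pairwise. If [v] has the deepest top, every other subtree starts no
   deeper and meets that of [v], so it contains this top: the whole clique lies in one bag. *)
have [v vQ mv] := arg_maxnP (fun v => dep (tp v)) q0Q.
apply: leq_trans (cB (tp v)); apply/subset_leq_card/subsetP => u uQ.
have /andP[tpv sv] := tpP v; have /andP[tpu su] := tpP u.
have [->|uv] := eqVneq u v; first by rewrite inE in tpv.
have [z /andP[uz vz]] := hE _ _ (clQ _ _ uQ vQ uv).
have := conn_meet_top rT (vertex_nodes_conn tB u) sv tpu (mv _ uQ) (z := z).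
by rewrite !inE; apply.
Qed.

(** * Paths, cones and iterated cones *)

Section PathGraph.
Variable n : nat.

Definition path_adj : rel 'I_n := fun i j => (i.+1 == j :> nat) || (j.+1 == i :> nat).

Lemma path_adj_sym : symmetric path_adj.
Proof. by move=> i j; rewrite /path_adj orbC. Qed.

Lemma path_adj_irrefl : irreflexive path_adj.
Proof. by move=> i; rewrite /path_adj orbb; apply/eqP; lia. Qed.

Definition path_graph := SGraph path_adj_sym path_adj_irrefl.

End PathGraph.

Section Cone.
Variables (M : nat) (G : sgraph).

(** [None] is the dominant vertex, and [Some (i, x)] is the vertex [x] of copy [i]. *)
Definition cone_adj : rel (option ('I_M * G)) := fun a b =>
  match a, b with
  | None, None => false
  | Some x, Some y => (x.1 == y.1) && sadj x.2 y.2
  | _, _ => true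
  end.

Lemma cone_adj_sym : symmetric cone_adj.
Proof. by move=> [x|] [y|] //=; rewrite eq_sym sadj_sym. Qed.

Lemma cone_adj_irrefl : irreflexive cone_adj.
Proof. by case=> [x|] //=; rewrite sadj_irrefl andbF. Qed.

Definition cone := SGraph cone_adj_sym cone_adj_irrefl.

Definition copy (i : 'I_M) (x : G) : cone := Some (i, x).

Lemma copy_inj i : injective (copy i).
Proof. by move=> x y []. Qed.

Lemma copy_adj i x y : sadj (copy i x) (copy i y) = sadj x y.
Proof. by rewrite /= eqxx. Qed.

End Cone.

(* The index is shifted: [iterated_cone M r] has treewidth r + 1. *)
Fixpoint iterated_cone (M r : nat) : sgraph :=
  if r is r'.+1 then cone M.+1 (iterated_cone M r') else path_graph M.+1.

Definition elimination (H : sgraph) c := exists (rk : H -> nat) (up : H -> {set H}),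
  [/\ forall v, #|up v| <= c,
      forall v u, u \in up v -> rk u < rk v,
      forall v u w, u \in up v -> w \in up v -> u != w -> u \in up w \/ w \in up u &
      forall u v, sadj u v -> u \in up v \/ v \in up u].

Lemma elimination_path n : elimination (path_graph n) 1.
Proof.
exists (@nat_of_ord n), (fun i : 'I_n => [set j : 'I_n | j.+1 == i :> nat]); split.
- move=> i; rewrite leqNgt; apply/negP => /card_gt1P[a [b []]]; rewrite !inE => /eqP ai /eqP bi.
  by case/eqP; apply: val_inj => /=; lia.
- by move=> i j; rewrite inE => /eqP <-.
- move=> i j k; rewrite !inE => /eqP ji /eqP ki.
  by case/eqP; apply: val_inj => /=; lia.
- by move=> i j; rewrite !inE => /orP.
Qed.

(** The dominant vertex comes first in the ordering and joins every earlier neighbourhood. *)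
Lemma elimination_cone M G c : elimination G c -> elimination (cone M G) c.+1.
Proof.
case=> rk [up [h1 h2 h3 h4]].
pose up' (a : cone M G) : {set cone M G} := if a is Some ix then None |: (copy ix.1 @: up ix.2) else set0.
exists (fun a : cone M G => if a is Some ix then (rk ix.2).+1 else 0), up'; split.
- case=> [[i x]|] /=; last by rewrite cards0.
  rewrite cardsU1 -[c.+1]add1n leq_add //; first by case: (_ \notin _).
  by rewrite card_imset //; apply: copy_inj.
- case=> [[i x]|] b /=; last by rewrite inE.
  by case/setU1P => [->//|/imsetP[y yx ->]] /=; rewrite ltnS h2.
- case=> [[i x]|] b d /=; last by rewrite inE.
  case/setU1P => [->|/imsetP[y yx ->]] /setU1P[->|/imsetP[z zx ->]] //=; try by rewrite setU11; auto.
  move=> yz; have yz' : y != z by apply: contraNneq yz => ->.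
  by case: (h3 _ _ _ yx zx yz') => h; [left|right]; apply/setU1r/imset_f.
- case=> [[i x]|] [[j y]|] //=; try by rewrite setU11; auto.
  move=> /andP[/eqP <- /h4[]h]; by [left; apply/setU1r/imset_f|right; apply/setU1r/imset_f].
Qed.

Lemma tw_le_iterated_cone M r : tw_le (iterated_cone M r) r.+1.
Proof.
have : elimination (iterated_cone M r) r.+1.
  by elim: r => [|r IH]; [apply: elimination_path|apply: elimination_cone].
by case=> rk [up [h1 h2 h3 h4]]; apply: tw_le_elimination h1 h2 h3 h4.
Qed.

(** The clause on the image of [part] feeds the induction: it makes the part of the dominant vertex
    distinct from, and adjacent to, every part of the clique found in a copy. *)
Lemma iterated_cone_clique M r (H : sgraph) (part : iterated_cone M r -> H) :
  H_partition part -> partition_width_le part M ->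
  exists Q : {set H}, [/\ #|Q| = r.+2, Q \subset part @: setT & {in Q &, forall u v, u != v -> sadj u v}].
Proof.
elim: r part => [|r IH] part hp hw.
  (* The path has [M.+1] vertices, too many for a single part, so some edge joins two parts. *)
  have [i [j [ij pij]]] : exists i j : path_graph M.+1, sadj i j /\ part i != part j.
    apply: NNPP => no.
    have all0 (i : 'I_M.+1) : part i = part ord0.
      case: i => m; elim: m => [|m IHm] lt; first by congr part; apply: val_inj.
      rewrite -(IHm (ltnW lt)); apply/eqP/negPn/negP => ne; apply: no.
      exists (Ordinal lt), (Ordinal (ltnW lt)); split=> //=.
      by rewrite /path_adj /= eqxx orbT.
    have := hw (part ord0); rewrite (_ : [set _ | _] = setT) ?cardsT ?card_ord ?ltnn //.
    by apply/setP => i; rewrite !inE all0 eqxx.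
  have aij : sadj (part i) (part j) by case: (hp _ _ ij) => // e; rewrite e eqxx in pij.
  exists [set part i; part j]; split; first by rewrite cards2 pij.
    by apply/subsetP => h /set2P[]->; apply: imset_f.
  by move=> u v /set2P[]-> /set2P[]->; rewrite ?eqxx // => _; rewrite sadj_sym.
(* If each of the [M.+1] copies met the part of the dominant vertex, that part would have more than
   [M] vertices. *)
have [i iP] : exists i : 'I_M.+1, forall x, part (copy i x) != part None.
  apply: NNPP => no.
  have hx i : exists x, part (copy i x) == part None.
    by apply: NNPP => nx; apply: no; exists i => x; apply/negP => e; apply: nx; exists x.
  pose f i : iterated_cone M r.+1 := copy i (xchoose (hx i)).
  have fi : injective f by move=> i j [].
  have := hw (part None); rewrite leqNgt => /negP; apply.
  apply: (@leq_trans #|f @: setT|); first by rewrite card_imset // cardsT card_ord.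
  by apply/subset_leq_card/subsetP => a /imsetP[i _ ->]; rewrite inE (xchooseP (hx i)).
have [|c|Q [cQ sQ clQ]] := IH (fun x => part (copy i x)).
- by move=> v w vw; apply: hp; rewrite copy_adj.
- apply: leq_trans (hw c); rewrite -(card_imset _ (@copy_inj M.+1 _ i)).
  by apply/subset_leq_card/subsetP => a /imsetP[x]; rewrite !inE => h ->.
have nQ : part None \notin Q.
  by apply/negP => /(subsetP sQ)/imsetP[x _ E]; move: (iP x); rewrite E eqxx.
have aQ h : h \in Q -> sadj (part None) h.
  move=> /(subsetP sQ)/imsetP[x _ ->]; have [E|//] := hp None (copy i x) isT.
  by move: (iP x); rewrite E eqxx.
exists (part None |: Q); split.
- by rewrite cardsU1 nQ cQ.
- apply/subsetP => h /setU1P[->|/(subsetP sQ)/imsetP[x _ ->]]; exact: imset_f.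
- move=> u v /setU1P[->|uQ] /setU1P[->|vQ] uv; [by rewrite eqxx in uv| | |exact: clQ].
    exact: aQ.
  by rewrite sadj_sym aQ.
Qed.

Lemma setD1_notin (I : finType) (A : {set I}) x : x \notin A -> A :\ x = A.
Proof. by move=> h; apply/setDidPl; rewrite disjoint_sym disjoints1. Qed.

(** * Models of complete bipartite minors *)

Section BipartiteModels.
Variable G : sgraph.
Implicit Types (XX YY : {set {set G}}) (X Y : {set G}).

Definition bip_pair XX YY := [/\ branch_sets (XX :|: YY), [disjoint XX & YY] &
  forall X Y, X \in XX -> Y \in YY -> touch X Y].

(** The sizes are lower bounds, which makes the notion monotone in [m] and [n]. *)
Definition bip_model m n := exists XX YY, [/\ m <= #|XX|, n <= #|YY| & bip_pair XX YY].

Lemma bip_pairS XX YY XX' YY' :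
  XX' \subset XX -> YY' \subset YY -> bip_pair XX YY -> bip_pair XX' YY'.
Proof.
move=> sX sY [h1 h2 h3]; split.
- by apply: branch_setsS h1; apply: setUSS.
- exact: disjointW h2.
- by move=> X Y /(subsetP sX) h /(subsetP sY); apply: h3.
Qed.

Lemma bip_pair_sym XX YY : bip_pair XX YY -> bip_pair YY XX.
Proof.
case=> h1 h2 h3; split; rewrite 1?setUC 1?disjoint_sym // => X Y h h'.
by rewrite touchC h3.
Qed.

Lemma bip_model_sym m n : bip_model m n -> bip_model n m.
Proof. by move=> [XX [YY [h1 h2 /bip_pair_sym h3]]]; exists YY, XX. Qed.

Lemma bip_model_le m n m' n' : m' <= m -> n' <= n -> bip_model m n -> bip_model m' n'.
Proof.
move=> hm hn [XX [YY [h1 h2 h3]]]; exists XX, YY.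
by rewrite (leq_trans hm h1) (leq_trans hn h2).
Qed.

Lemma minor_bip_model s t : minor (K_bip s t) G -> bip_model s t.
Proof.
case=> phi [h1 h2 h3 h4].
have inj : injective phi.
  move=> x y E; apply/eqP; apply: contraT => /h2; rewrite E -setI_eq0 setIid => e.
  by move: (h1 y); rewrite e.
pose XX := [set phi (inl i : K_bip s t) | i : 'I_s]; pose YY := [set phi (inr i : K_bip s t) | i : 'I_t].
exists XX, YY; split.
- by rewrite card_imset ?card_ord // => i j /inj [].
- by rewrite card_imset ?card_ord // => i j /inj [].
have im X : X \in XX :|: YY -> exists x, X = phi x.
  by case/setUP => /imsetP[i _ ->]; [exists (inl i)|exists (inr i)].
split.
- apply/branch_setsP; split=> [X Y /im[x ->] /im[y ->] XY|X /im[x ->]|X /im[x ->]] //.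
    by apply: h2; apply: contraNneq XY => ->.
  exact/connP/h3.
- by apply/pred0Pn => -[X /andP[/= /imsetP[i _ ->] /imsetP[j _ /inj]]].
- move=> X Y /imsetP[i _ ->] /imsetP[j _ ->]; have [//|v [w /and3P[hv hw vw]]] := h4 (inl i) (inr j).
  by apply/touchP; exists v, w.
Qed.

(** At most one branch set contains [v]; deleting it costs one member on one side only. *)
Lemma bip_pair_remove XX YY v : bip_pair XX YY ->
  exists XX' YY', [/\ bip_pair XX' YY', forall X, X \in XX' :|: YY' -> v \notin X &
    (#|XX| <= #|XX'|.+1 /\ YY' = YY) \/ (XX' = XX /\ #|YY| <= #|YY'|.+1)].
Proof.
move=> bp; have [/branch_setsP[d _ _] dis _] := bp.
have uniq X Z : X \in XX :|: YY -> Z \in XX :|: YY -> v \in X -> v \in Z -> X = Z.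
  move=> XU ZU vX vZ; apply/eqP; apply: contraT => /(d _ _ XU ZU)/pred0P/(_ v).
  by rewrite /= vX vZ.
have [/existsP[X0 /andP[X0U vX0]]|no] := boolP [exists X0, (X0 \in XX :|: YY) && (v \in X0)]; last first.
  exists XX, YY; split=> // [X XU|]; last by left.
  by apply/negP => vX; case/existsP: no; exists X; rewrite XU.
exists (XX :\ X0), (YY :\ X0); split.
- by apply: bip_pairS bp; apply: subsetDl.
- move=> X; rewrite -setDUl => /setD1P[XX0 XU]; apply: contraNN XX0 => vX.
  by rewrite (uniq X X0).
- case/setUP: X0U => h; [left|right].
    split; first by rewrite (cardsD1 X0 XX) h.
    by apply: setD1_notin; apply: contraTN dis => h'; apply/pred0Pn; exists X0; rewrite /= h.
  split; last by rewrite (cardsD1 X0 YY) h.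
  by apply: setD1_notin; apply: contraTN dis => h'; apply/pred0Pn; exists X0; rewrite /= h'.
Qed.

End BipartiteModels.

(** * Pulling models back along induced embeddings *)

Section PullBack.
Variables (G G' : sgraph) (f : G -> G').
Hypothesis f_inj : injective f.
Hypothesis f_adj : forall x y, sadj (f x) (f y) = sadj x y.

Lemma conn_preim (X : {set G'}) : X \subset f @: setT -> conn X -> conn (f @^-1: X).
Proof.
move=> sX cX; have [->|[x xX]] := set_0Vmem (f @^-1: X); first exact: conn0.
rewrite inE in xX; apply: (@conn_hub _ _ x) => y; rewrite inE => yX.
pose A := [pred z | [forall w, (z == f w) ==> connect (inrel (f @^-1: X)) x w]].
suff: f y \in A by move=> /forallP/(_ y); rewrite eqxx.
apply: (conn_ind cX xX) yX.
  by apply/forallP => w; apply/implyP => /eqP/f_inj <-.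
move=> u v uX vX uv /forallP uA; apply/forallP => w; apply/implyP => /eqP E.
have /imsetP[u' _ Eu] := subsetP sX _ uX; have := uA u'; rewrite Eu eqxx /= => c.
apply: connect_trans c _; apply: connect1.
by rewrite inrelE !inE -Eu -E uX vX -f_adj -Eu -E uv.
Qed.

Lemma bip_pair_preim (XX YY : {set {set G'}}) :
  (forall X, X \in XX :|: YY -> X \subset f @: setT) -> bip_pair XX YY ->
  bip_model G #|XX| #|YY|.
Proof.
move=> sub [/branch_setsP[h1 h2 h3] dis tch].
pose pr (X : {set G'}) := f @^-1: X.
have prK X : X \in XX :|: YY -> f @: (pr X) = X.
  move=> /sub/subsetP sX; apply/setP => z; apply/imsetP/idP => [[x]|zX].
    by rewrite inE => h ->.
  by have /imsetP[x _ E] := sX z zX; exists x; rewrite // inE -E.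
have inj : {in XX :|: YY &, injective pr} by move=> X Y XU YU E; rewrite -(prK X) // E prK.
exists (pr @: XX), (pr @: YY); split.
- by rewrite card_in_imset // => X Y h h'; apply: inj; rewrite inE ?h ?h' ?orbT.
- by rewrite card_in_imset // => X Y h h'; apply: inj; rewrite inE ?h ?h' ?orbT.
split.
- rewrite -imsetU; apply/branch_setsP; split.
  + move=> _ _ /imsetP[X XU ->] /imsetP[Y YU ->] ne.
    have XY : X != Y by apply: contraNneq ne => ->.
    apply/pred0Pn => -[x /andP[/=]]; rewrite !inE => xX xY.
    by have /pred0P/(_ (f x)) := h1 _ _ XU YU XY; rewrite /= xX xY.
  + move=> _ /imsetP[X XU ->]; have := h2 X XU; apply: contraNneq => E.
    by rewrite -(prK X) // E imset0.
  + by move=> _ /imsetP[X XU ->]; apply: conn_preim (sub _ XU) (h3 _ XU).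
- apply/pred0Pn => -[_ /andP[/= /imsetP[X XX' ->] /imsetP[Y YY' E]]].
  have e : X = Y by apply: inj E; rewrite inE ?XX' ?YY' ?orbT.
  by case/pred0Pn: dis; exists X; rewrite /= XX' e YY'.
- move=> _ _ /imsetP[X XX' ->] /imsetP[Y YY' ->].
  have XU : X \in XX :|: YY by rewrite inE XX'.
  have YU : Y \in XX :|: YY by rewrite inE YY' orbT.
  have /touchP[x [y [xX yY xy]]] := tch _ _ XX' YY'.
  have /imsetP[x' _ Ex] := subsetP (sub _ XU) _ xX; have /imsetP[y' _ Ey] := subsetP (sub _ YU) _ yY.
  by apply/touchP; exists x', y'; rewrite !inE -Ex -Ey -f_adj -Ex -Ey.
Qed.

End PullBack.

(** * Complete bipartite minors of cones *)

Section ConeMinors.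
Variables (M : nat) (G : sgraph).

Lemma conn_in_copy (X : {set cone M G}) i x : conn X -> None \notin X -> copy i x \in X ->
  X \subset copy i @: setT.
Proof.
move=> cX nX xX; apply/subsetP; apply: (conn_ind cX xX); first exact: imset_f.
move=> [[j y]|] [[k z]|] uX vX //=; rewrite ?(negPf nX) // in uX vX *.
move=> /andP[/= /eqP <- _] /imsetP[w _ [-> _]]; exact: imset_f.
Qed.

(** Without the dominant vertex each branch set lies in one copy, and touching sets lie in the same
    one. A fixed [X0] forces all of [YY] into its copy, and a fixed [Y0] then does so for [XX]. *)
Lemma bip_pair_in_copy (XX YY : {set {set cone M G}}) :
  bip_pair XX YY -> (forall X, X \in XX :|: YY -> None \notin X) ->
  0 < #|XX| -> 0 < #|YY| -> bip_model G #|XX| #|YY|.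
Proof.
move=> bp nU /card_gt0P[X0 X0X] /card_gt0P[Y0 Y0Y].
have [/branch_setsP[h1 h2 h3] dis tch] := bp.
have incopy X : X \in XX :|: YY -> exists i, X \subset copy i @: setT.
  move=> XU; have /set0Pn[[[i x]|] xX] := h2 X XU; last by move: (nU X XU); rewrite xX.
  by exists i; apply: conn_in_copy (h3 X XU) (nU X XU) xX.
have same X Y i : X \in XX :|: YY -> Y \in XX :|: YY -> touch X Y -> X \subset copy i @: setT ->
    Y \subset copy i @: setT.
  move=> XU YU /touchP[u [v [uX vY uv]]] sX; have [j sY] := incopy Y YU.
  have /imsetP[x _ Eu] := subsetP sX _ uX; have /imsetP[y _ Ev] := subsetP sY _ vY.
  by move: uv; rewrite Eu Ev => /andP[/= /eqP -> _].
have [i sX0] : exists i, X0 \subset copy i @: setT by apply: incopy; rewrite inE X0X.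
have inX X : X \in XX -> X \in XX :|: YY by rewrite inE => ->.
have inY Y : Y \in YY -> Y \in XX :|: YY by rewrite inE orbC => ->.
have subY Y : Y \in YY -> Y \subset copy i @: setT.
  by move=> YY'; apply: (same X0) => //; [exact: inX|exact: inY|exact: tch].
apply: (@bip_pair_preim _ _ (copy i)) bp; [exact: copy_inj|exact: copy_adj|].
move=> X /setUP[XX'|/subY//]; apply: (same Y0); [exact: inY|exact: inX| |exact: subY].
by rewrite touchC tch.
Qed.

Lemma cone_bip_model m n : 0 < m -> 0 < n ->
  bip_model (cone M G) m.+1 n.+1 -> bip_model G m n.+1 \/ bip_model G m.+1 n.
Proof.
move=> m0 n0 [XX [YY [cX cY bp]]].
have [XX' [YY' [bp' nU cases]]] := bip_pair_remove (None : cone M G) bp.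
have gX : m <= #|XX'| by case: cases => [[h _]|[-> _]]; [rewrite -ltnS; apply: leq_trans h|apply: ltnW].
have gY : n <= #|YY'| by case: cases => [[_ ->]|[_ h]]; [apply: ltnW|rewrite -ltnS; apply: leq_trans h].
have := bip_pair_in_copy bp' nU (leq_trans m0 gX) (leq_trans n0 gY).
case: cases => [[h E]|[E h]] bm; [left|right]; apply: bip_model_le bm => //; by rewrite E.
Qed.

End ConeMinors.

(** * Complete bipartite minors of paths *)

Section PathMinors.
Variable n : nat.
Implicit Types X Y Z : {set path_graph n}.

Definition precedes X Y := forall x y : 'I_n, x \in X -> y \in Y -> x < y.

(** If [X] skipped [j], being less than [j] would propagate along the edges inside [X] from [i] to
    [k]. *)
Lemma conn_interval X (i j k : 'I_n) : conn X -> i \in X -> k \in X -> i <= j -> j <= k -> j \in X.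
Proof.
move=> cX iX kX ij jk; apply: contraT => jX.
have ltij : i < j by rewrite ltn_neqAle ij andbT; apply: contraNneq jX => /val_inj <-.
suff : k \in [pred u : 'I_n | u < j] by rewrite inE ltnNge jk.
apply: (conn_ind cX iX) kX => // u v uX vX; rewrite !inE /= /path_adj => uv uj.
have : v != j by apply: contraNneq jX => <-.
rewrite -val_eqE /=; move: uv uj; clear; lia.
Qed.

Lemma precedesVprecedes X Y : conn X -> conn Y -> X != set0 -> Y != set0 -> [disjoint X & Y] ->
  precedes X Y \/ precedes Y X.
Proof.
have key X' Y' (x0 y0 : 'I_n) : conn X' -> conn Y' -> [disjoint X' & Y'] -> x0 \in X' -> y0 \in Y' -> x0 < y0 ->
    precedes X' Y'.
  move=> cX cY dis x0X y0Y lt x y xX yY.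
  have no z : z \in X' -> z \in Y' -> False.
    by move=> zX zY; case/pred0Pn: dis; exists z; rewrite /= zX.
  have xy0 : x < y0.
    rewrite ltnNge; apply/negP => le; apply: (no y0) => //.
    exact: conn_interval cX x0X xX (ltnW lt) le.
  rewrite ltnNge; apply/negP => le; apply: (no x) => //.
  exact: conn_interval cY yY y0Y le (ltnW xy0).
move=> cX cY /set0Pn[x0 x0X] /set0Pn[y0 y0Y] dis.
case: (ltngtP (x0 : 'I_n) (y0 : 'I_n)) => [lt|lt|e].
- by left; apply: key lt.
- by right; apply: key lt; rewrite // disjoint_sym.
- by case/pred0Pn: dis; exists x0; rewrite /= x0X (val_inj e).
Qed.

(** Both sets contain the successor of the last vertex of [X]. *)
Lemma precedes_touch_meet X Y Y' : precedes X Y -> precedes X Y' -> touch X Y -> touch X Y' ->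
  ~~ [disjoint Y & Y'].
Proof.
move=> pY pY' /touchP[x [y [xX yY xy]]] /touchP[x' [y' [x'X y'Y xy']]].
apply/pred0Pn; exists y; rewrite /= yY (_ : y = y') //; apply: val_inj => /=.
move: xy xy' (pY _ _ xX yY) (pY' _ _ xX y'Y) (pY _ _ x'X yY) (pY' _ _ x'X y'Y).
by rewrite /= /path_adj; clear; lia.
Qed.

Lemma touch_precedes_meet X Y Y' : precedes Y X -> precedes Y' X -> touch X Y -> touch X Y' ->
  ~~ [disjoint Y & Y'].
Proof.
move=> pY pY' /touchP[x [y [xX yY xy]]] /touchP[x' [y' [x'X y'Y xy']]].
apply/pred0Pn; exists y; rewrite /= yY (_ : y = y') //; apply: val_inj => /=.
move: xy xy' (pY _ _ yY xX) (pY' _ _ y'Y xX) (pY _ _ yY x'X) (pY' _ _ y'Y x'X).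
by rewrite /= /path_adj; clear; lia.
Qed.

Lemma precedes_between X Y Z : X != set0 -> precedes Y X -> precedes X Z -> ~~ touch Y Z.
Proof.
case/set0Pn => x xX YX XZ; apply/touchP => -[y [z [yY zZ]]].
by move: (YX _ _ yY xX) (XZ _ _ xX zZ); rewrite /= /path_adj; clear; lia.
Qed.

(** Two of the three sets would lie on the same side of [X] and both touch it, so they would
    meet. *)
Lemma path_no_K13 : ~ bip_model (path_graph n) 1 3.
Proof.
move=> [XX [YY [/card_gt0P[X XX'] /card_gt2P[Y1 [Y2 [Y3 [[Y1Y Y2Y Y3Y] [n12 n23 n31]]]]] [/branch_setsP[h1 h2 h3] dis tch]]]].
have XU : X \in XX :|: YY by rewrite inE XX'.
have inY Y : Y \in YY -> Y \in XX :|: YY by rewrite inE orbC => ->.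
have side Y : Y \in YY -> precedes X Y \/ precedes Y X.
  move=> YY'; have YU := inY Y YY'; apply: precedesVprecedes; auto; apply: h1 => //.
  by apply: contraTneq dis => E; apply/pred0Pn; exists X; rewrite /= XX' E.
have fwd Y Y' : Y \in YY -> Y' \in YY -> Y != Y' -> precedes X Y -> precedes X Y' -> False.
  move=> YY' YY'' ne p p'; have := precedes_touch_meet p p' (tch _ _ XX' YY') (tch _ _ XX' YY'').
  by rewrite h1 //; apply: inY.
have bwd Y Y' : Y \in YY -> Y' \in YY -> Y != Y' -> precedes Y X -> precedes Y' X -> False.
  move=> YY' YY'' ne p p'; have := touch_precedes_meet p p' (tch _ _ XX' YY') (tch _ _ XX' YY'').
  by rewrite h1 //; apply: inY.
case: (side Y1 Y1Y) (side Y2 Y2Y) (side Y3 Y3Y) => s1 [] s2 [] s3.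
all: try exact: (fwd Y1 Y2); try exact: (fwd Y2 Y3); try exact: (fwd Y3 Y1);
  try exact: (bwd Y1 Y2); try exact: (bwd Y2 Y3); try exact: (bwd Y3 Y1).
Qed.

(** If [Y] and [Y'] are on the same side of [X] they meet. Otherwise [X] separates them, and [X'],
    lying on one side of [X], cannot touch both. *)
Lemma path_no_K22 : ~ bip_model (path_graph n) 2 2.
Proof.
move=> [XX [YY [/card_gt1P[X [X' [XX' X'X nX]]] /card_gt1P[Y [Y' [YY' Y'Y nY]]] [/branch_setsP[h1 h2 h3] dis tch]]]].
have inX Z : Z \in XX -> Z \in XX :|: YY by rewrite inE => ->.
have inY Z : Z \in YY -> Z \in XX :|: YY by rewrite inE orbC => ->.
have side Z : Z \in XX :|: YY -> X != Z -> precedes X Z \/ precedes Z X.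
  by move=> ZU ne; apply: precedesVprecedes; auto.
have nXY Z : Z \in YY -> X != Z.
  by move=> ZY; apply: contraTneq dis => E; apply/pred0Pn; exists X; rewrite /= XX' E.
have dY : [disjoint Y & Y'] by apply: h1; auto.
have X0 : X != set0 by auto.
have absurd Z Z' : Z \in YY -> Z' \in YY -> precedes Z X -> precedes X Z' -> False.
  move=> ZY Z'Y pZ pZ'; case: (side X' (inX _ X'X) nX) => p.
    by have /negP := precedes_between X0 pZ p; rewrite touchC; apply; apply: tch.
  by have /negP := precedes_between X0 p pZ'; apply; apply: tch.
case: (side Y (inY _ YY') (nXY _ YY')) (side Y' (inY _ Y'Y) (nXY _ Y'Y)) => p [] p'.
- by have := precedes_touch_meet p p' (tch _ _ XX' YY') (tch _ _ XX' Y'Y); rewrite dY.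
- exact: (absurd Y' Y).
- exact: (absurd Y Y').
- by have := touch_precedes_meet p p' (tch _ _ XX' YY') (tch _ _ XX' Y'Y); rewrite dY.
Qed.

End PathMinors.

(** Removing the dominant vertex may shrink either side of a model, so two statements are carried
    through the induction, one for each outcome. *)
Lemma iterated_cone_no_bip_model M r :
  (forall t, maxn r.+1 3 <= t -> ~ bip_model (iterated_cone M r) r.+1 t) /\
  (forall t, maxn r.+1 2 <= t -> ~ bip_model (iterated_cone M r) r.+2 t).
Proof.
elim: r => [|r [IH1 IH2]].
  split=> t; rewrite geq_max => /andP[_ h] bm.
    by apply: path_no_K13; apply: bip_model_le bm.
  by apply: path_no_K22; apply: bip_model_le bm.
have P1 t : maxn r.+2 3 <= t -> ~ bip_model (iterated_cone M r.+1) r.+2 t.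
  case: t => [|t]; first by rewrite geq_max andbF.
  rewrite geq_max => /andP[h1 h2] bm; have [] := cone_bip_model _ _ bm => //; first by lia.
    by apply: IH1; rewrite geq_max h2 andbT; apply: ltnW.
  by apply: IH2; rewrite geq_max; apply/andP; split; rewrite -ltnS.
split=> // t; rewrite geq_max => /andP[h1 h2] bm.
have [h3|h3] := leqP 3 t.
  by apply: (P1 t); [rewrite geq_max h1|apply: bip_model_le bm].
(* Here [t] is 2 and [r] is 0: a model of sizes 3 and 2 is one of sizes 2 and 3 with the sides
   exchanged. *)
apply: (P1 3); first by rewrite geq_max (leq_trans h1 (ltnW h3)).
by apply/bip_model_sym; apply: bip_model_le bm.
Qed.

Lemma exists_is_tw (G : sgraph) c : tw_le G c -> exists2 k, k <= c & is_tw G k.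
Proof.
elim/ltn_ind: c => c IH hc.
case: (classic (exists2 j, j < c & tw_le G j)) => [[j jc hj]|no].
  by have [k kj hk] := IH j jc hj; exists k => //; apply: leq_trans kj (ltnW jc).
by exists c => //; split => // j jc hj; apply: no; exists j.
Qed.

Lemma iterated_cone_free M r t : maxn r.+1 3 <= t -> Kst_minor_free r.+1 t (iterated_cone M r).
Proof. by move=> ht /minor_bip_model; apply: (iterated_cone_no_bip_model M r).1. Qed.

Lemma utw_lower_bound s t c : maxn s 3 <= t -> c < s -> ~ utw_bounded (Kst_minor_free s t) c.
Proof.
case: s => // r hts cs [f hf].
(* The treewidth of the graph is only known to be at most [r.+1], and the graph depends on [M], so
   [M] bounds [f] at all these values at once. *)
pose M := \max_(k < r.+2) f k; pose G := iterated_cone M r.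
have [k kr hk] := exists_is_tw (tw_le_iterated_cone M r).
have [H [part [twH [hp hw]]]] := hf G (iterated_cone_free (M := M) hts) k hk.
have kM : f k <= M by have lt : k < r.+2 := kr; apply: (leq_bigmax (Ordinal lt)).
have [Q [cQ _ clQ]] := iterated_cone_clique hp (fun x => leq_trans (hw x) kM).
by have := clique_card_tw twH clQ; rewrite cQ ltnS leqNgt cs.
Qed.

(** * Numerical estimates and conclusion *)

Lemma width_bound_quadratic s t k : 1 < k ->
  width_bound s t k.+1 <= (4 * (s`! * t) * (4 * s).+1) * (k * k).
Proof.
move=> k1; rewrite /width_bound /part_number.
have h1 : k.+1 <= 2 * k by lia.
have h2 : (s * (2 * k.+1)).+1 <= (4 * s).+1 * k by nia.
apply: (@leq_trans (2 * (s`! * t * ((4 * s).+1 * k)) * (2 * k))); last by nia.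
by apply: leq_mul => //; rewrite leq_mul2l leq_mul2l h2 !orbT.
Qed.

(** For [k] at least 2 the quotient [ln k / ln 2] is at least 1, so dividing the constant by [ln 2]
    lets the logarithm be inserted. *)
Lemma INR_square_le_log m C k : m <= C * (k * k) -> 1 < k ->
  Rle (INR m) (Rmult (Rmult (Rdiv (INR C) (ln 2)) (pow (INR k) 2)) (ln (INR k))).
Proof.
move=> hm k1.
have hl2 : Rlt 0 (ln 2) by rewrite -ln_1; apply: ln_increasing; lra.
have hk : Rle 2 (INR k) by have := le_INR 2 k; rewrite /=; move=> h; have {h} := h (elimT leP k1); lra.
have hln : Rle (ln 2) (ln (INR k)).
  by case: hk => [h|<-]; [left; apply: ln_increasing; lra|right].
have hm' : Rle (INR m) (Rmult (INR C) (pow (INR k) 2)).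
  have /leP/le_INR := hm; rewrite -multE !mult_INR /=; lra.
apply: Rle_trans hm' _.
have C0 := pos_INR C; have p0 : Rle 0 (pow (INR k) 2) by apply: pow_le; lra.
have -> : Rmult (Rmult (Rdiv (INR C) (ln 2)) (pow (INR k) 2)) (ln (INR k)) =
  Rmult (Rmult (INR C) (pow (INR k) 2)) (Rdiv (ln (INR k)) (ln 2)) by field; lra.
rewrite -{1}[Rmult _ _]Rmult_1_r; apply: Rmult_le_compat_l; first exact: Rmult_le_pos.
apply: (Rmult_le_reg_r (ln 2)) => //; rewrite Rmult_1_l /Rdiv Rmult_assoc Rinv_l; lra.
Qed.


Theorem theorem5p5 (s t : nat) (hts : maxn s 3 <= t) :
  underlying_tw_eq (Kst_minor_free s t) s /\
  exists C : R, forall G : sgraph, Kst_minor_free s t G ->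
    forall k : nat, 2 <= k -> is_tw G k ->
      exists m : nat, tpw_le s G m /\
        Rle (INR m) (Rmult (Rmult C (pow (INR k) 2)) (ln (INR k))).
Proof.
have t0 : 0 < t by move: hts; rewrite geq_max => /andP[_]; apply: leq_trans.
have upper G k : Kst_minor_free s t G -> is_tw G k -> tpw_le s G (width_bound s t k.+1).
  by move=> fG [hk _]; apply: tw_le_tpw_le.
split.
  split; last by move=> c cs; apply: utw_lower_bound.
  by exists (fun k => width_bound s t k.+1) => G fG k; apply: upper.
exists (Rdiv (INR (4 * (s`! * t) * (4 * s).+1)) (ln 2)) => G fG k k2 hk.
exists (width_bound s t k.+1); split; first exact: upper.
by apply: INR_square_le_log => //; apply: width_bound_quadratic.
Qed.
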